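(* If a countable relational structure $R$ is prehomogeneous and has a finite monomorphic decomposition, then $\mathrm{sib}(R)=1$ or $\mathrm{sib}(R)=2^{\aleph_0}$.
   Context: A relational structure with domain $E$ is $R=(E,(\rho_i)_{i\in I})$ with $\rho_i\subseteq E^{n_i}$. For $A\subseteq E$, $R_{\restriction A}=(A,(A^{n_i}\cap\rho_i)_{i\in I})$. A local isomorphism of $R$ is an isomorphism from a restriction $R_{\restriction F}$ onto a restriction $R_{\restriction F'}$. A structure $S$ embeds into $R$ if $S$ is isomorphic to a restriction of $R$. A sibling of $R$ is a structure $S$ such that $S$ embeds into $R$ and $R$ embeds into $S$; $\mathrm{sib}(R)$ is the number of siblings up to isomorphism. $R$ is prehomogeneous if for every finite $F\subseteq E$ there is a finite $F'$ with $F\subseteq F'\subseteq E$ such that every local isomorphism of $R$ with domain $F$ extends to an automorphism of $R$ provided that it extends to a local isomorphism with domain $F'$. A subset $E'\subseteq E$ is a monomorphic part of $R$ if for every integer $k$ and every pair $A,A'$ of $k$-element subsets of $E$ with $A\setminus E'=A'\setminus E'$, the structures $R_{\restriction A}$ and $R_{\restriction A'}$ are isomorphic. A monomorphic decomposition of $R$ is a partition of $E$ into monomorphic parts; it is finite if it has finitely many blocks. *)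

(* Defs.v *)
From mathcomp Require Import all_boot.
From mathcomp Require Import boolp classical_sets functions cardinality.

Set Implicit Arguments.
Unset Strict Implicit.
Unset Printing Implicit Defensive.

Local Open Scope classical_set_scope.
Local Open Scope card_scope.

Record structure (I : Type) (ar : I -> nat) : Type := Structure {
  domain :> Type;
  rel_of : forall i : I, set ((ar i).-tuple domain)
}.
Arguments rel_of {I ar} s i.

Section Structures.
Context {I : Type} {ar : I -> nat}.
Implicit Types R S : structure ar.

(* {x : R | x \in A} is the unfolding of the library's set_type A; the constant
   set_type itself would force the universe of domains to be that of set,
   whereas sib below needs the type of structures to fit in the latter. *)
Definition restriction R (A : set R) : structure ar :=
  @Structure I ar {x : R | x \in A}
    (fun i => [set t | rel_of R i (map_tuple val t)]).

Definition isomorphism R S (f : R -> S) : Prop :=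
  bijective f /\
  forall (i : I) (t : (ar i).-tuple R),
    rel_of R i t <-> rel_of S i (map_tuple f t).

Definition isomorphic R S : Prop := exists f : R -> S, isomorphism f.

Definition embeds S R : Prop := exists A : set R, isomorphic S (restriction A).

Definition sibling R S : Prop := embeds S R /\ embeds R S.

(* The set of isomorphism classes of siblings of R; the cardinal sib(R) is
   its cardinality.  The domain of a sibling is an arbitrary type. *)
Definition sib R : set (set (structure ar)) :=
  [set [set T | isomorphic S T] | S in sibling R].

(* A local isomorphism of R with domain F is an isomorphism
   restriction F -> restriction G for some G : set R. *)
Definition extends_to_local_isomorphism R (F G : set R)
    (f : restriction F -> restriction G) (F' : set R) : Prop :=
  exists (G' : set R) (g : restriction F' -> restriction G'),
    isomorphism g /\
    forall (x : restriction F) (x' : restriction F'),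
      val x = val x' -> val (g x') = val (f x).

Definition extends_to_automorphism R (F G : set R)
    (f : restriction F -> restriction G) : Prop :=
  exists g : R -> R, isomorphism g /\
    forall x : restriction F, g (val x) = val (f x).

Definition prehomogeneous R : Prop :=
  forall F : set R, finite_set F ->
  exists F' : set R, [/\ finite_set F', F `<=` F' &
    forall (G : set R) (f : restriction F -> restriction G),
      isomorphism f -> extends_to_local_isomorphism f F' ->
      extends_to_automorphism f].

Definition monomorphic_part R (B : set R) : Prop :=
  forall (k : nat) (A A' : set R), A #= `I_k -> A' #= `I_k ->
    A `\` B = A' `\` B -> isomorphic (restriction A) (restriction A').

Definition monomorphic_decomposition R (P : set (set R)) : Prop :=
  partition P id [set: R] /\ (forall B, P B -> monomorphic_part B).

Definition has_finite_monomorphic_decomposition R : Prop :=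
  exists P : set (set R), finite_set P /\ monomorphic_decomposition P.

End Structures.

(* Main.v *)
From HB Require Import structures.
Require Import Defs.
From mathcomp Require Import all_boot.
From mathcomp Require Import boolp classical_sets functions cardinality filter.

(** The proof extracts from the monomorphic decomposition a linear order that
    controls R, and compares the siblings of R through it.

    The order. There are finitely many labels on the domain and a linear order
    such that every map that preserves labels and is increasing on each label
    class is a local isomorphism ([multichain], [decomposition_multichain]).
    Finite pieces of such an order come from ultrafilters on the blocks:
    sequences chosen generically with respect to them are indiscernible, and
    the monomorphic decomposition makes every finite restriction of R isomorphic
    to the restriction to such a sequence.  A limit along an ultrafilter on nat
    glues the finite pieces.

    Two points are interchangeable when their transposition is an automorphism.

    If every infinite label class consists of interchangeable points, then R is
    a finite set together with finitely many infinite classes of interchangeable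
    points.  A self-embedding of R permutes the finite set and cannot put points
    of distinct classes in a common class, so a subset that contains its image
    contains the finite set and meets every infinite class in an infinite set;
    moving points inside their classes maps R isomorphically onto this subset
    ([interchangeable_sibling]).  There is one sibling.

    Otherwise some infinite label class is ordered: not all its points are
    interchangeable.  Call y a replacement of x in a set D when the substitution
    of y for x is a local isomorphism on D minus y.  Consecutive points of a
    class replace each other, whereas a replacement between points with a third
    one between them and room on both sides makes it possible to slide any point
    of the class past a neighbour, hence to permute the class arbitrarily
    ([exch_fiber]).  By prehomogeneity a consecutive pair could be moved to a
    pair that is not consecutive, so an ordered class has no consecutive points
    ([fiber_dense]): it is dense, and every countable chain embeds into it.
    Therefore each point v of the ordered classes can be inflated to a finite
    chain with any number nu v of points, inside R itself, and the result still
    contains a copy of R. In the inflated structure these chains are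
    connected components of the replacement graph, and the other components
    are infinite or contained in finitely many finite label classes; so the
    set of the sizes larger than one that occur infinitely often depends on
    the isomorphism type only ([many_components_blowup]). Since it can be
    prescribed, there are as many siblings as sets of integers, and there
    cannot be more because a sibling is given by a subset of R. *)

Set Implicit Arguments.
Unset Strict Implicit.
Unset Printing Implicit Defensive.

Local Open Scope classical_set_scope.
Local Open Scope card_scope.

(** * Local isomorphisms as maps of the whole domain *)

HB.instance Definition _ (I : Type) (ar : I -> nat) (R : structure ar) :=
  gen_eqMixin (domain R).
HB.instance Definition _ (I : Type) (ar : I -> nat) (R : structure ar) :=
  gen_choiceMixin (domain R).

Section LocalIso.
Context {I : Type} {ar : I -> nat} {R : structure ar}.
Implicit Types (A B : set R) (f g : R -> R).

(** A local isomorphism is represented by a map of the whole domain, whose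
    values outside A are irrelevant: composition and restriction then need no
    dependent types. *)
Definition local_iso A f : Prop :=
  (forall x y, A x -> A y -> f x = f y -> x = y) /\
  (forall i (t : (ar i).-tuple R), (forall x, x \in (t : seq R) -> A x) ->
     rel_of R i t <-> rel_of R i (map_tuple f t)).

Lemma local_iso_id A : local_iso A id.
Proof.
split=> // i t _; have -> // : map_tuple id t = t.
by apply: val_inj; rewrite /= map_id.
Qed.

Lemma local_iso_sub A B f : A `<=` B -> local_iso B f -> local_iso A f.
Proof.
move=> AB [fI fR]; split=> [x y /AB Bx /AB By|i t tA]; first exact: fI.
by apply: fR => x /tA/AB.
Qed.

Lemma eq_local_iso A f g :
  (forall x, A x -> f x = g x) -> local_iso A f -> local_iso A g.
Proof.
move=> fg [fI fR]; split=> [x y Ax Ay|i t tA]; first by rewrite -!fg//; apply: fI.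
rewrite fR//; suff -> : map_tuple f t = map_tuple g t by [].
by apply: val_inj => /=; apply/eq_in_map => x /tA/fg.
Qed.

Lemma local_iso_comp A B f g : local_iso A f -> local_iso B g ->
  (forall x, A x -> B (f x)) -> local_iso A (g \o f).
Proof.
move=> [fI fR] [gI gR] fAB; split=> [x y Ax Ay /= /gI|i t tA].
  by move=> /(_ (fAB _ Ax) (fAB _ Ay)); apply: fI.
rewrite fR// gR; last by move=> _ /mapP[x /tA/fAB Bx ->].
suff -> : map_tuple g (map_tuple f t) = map_tuple (g \o f) t by [].
by apply: val_inj; rewrite /= map_comp.
Qed.

Lemma local_iso_cancel A B f g : local_iso B g -> local_iso A (g \o f) ->
  (forall x, A x -> B (f x)) -> local_iso A f.
Proof.
move=> [gI gR] [gfI gfR] fAB; split=> [x y Ax Ay fxy|i t tA].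
  by apply: gfI => //=; rewrite fxy.
rewrite gfR// [X in _ <-> X]gR; last by move=> _ /mapP[x /tA/fAB Bx ->].
suff -> : map_tuple g (map_tuple f t) = map_tuple (g \o f) t by [].
by apply: val_inj; rewrite /= map_comp.
Qed.

Lemma local_iso_inv A f g : local_iso A f -> (forall x, A x -> g (f x) = x) ->
  local_iso (f @` A) g.
Proof.
move=> [fI fR] gK; split=> [_ _ [x Ax <-] [y Ay <-]|i t tA].
  by rewrite !gK// => ->.
have AB x : x \in (t : seq R) -> A (g x) by move=> /tA[y Ay <-]; rewrite gK.
rewrite [X in _ <-> X]fR; last by move=> _ /mapP[x /AB Bx ->].
suff -> : map_tuple f (map_tuple g t) = t by [].
apply: val_inj; rewrite /= -map_comp -[RHS]map_id; apply/eq_in_map => x /tA.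
by case=> y Ay <- /=; rewrite gK.
Qed.

(** Being a local isomorphism only concerns pairs and tuples, so it can be
    tested on finite sets even when the arities are unbounded. *)
Lemma local_iso_finitary A f :
  (forall s : seq R, [set` s] `<=` A -> local_iso [set` s] f) -> local_iso A f.
Proof.
move=> H; split=> [x y Ax Ay|i t tA]; last first.
  by have [x /tA|_ /(_ i t)] := H t; [|apply].
have [z|+ _] := H [:: x; y]; last by apply=> //=; rewrite !inE eqxx ?orbT.
by rewrite /= !inE => /orP[] /eqP->.
Qed.

Lemma local_iso_inverse A f : local_iso A f ->
  exists g, [/\ local_iso (f @` A) g, forall x, A x -> g (f x) = x &
              forall y, (f @` A) y -> A (g y) /\ f (g y) = y].
Proof.
move=> fA.
pose g y := if pselect (exists2 x, A x & f x = y) is left e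
  then projT1 (cid2 e) else y.
have gK x : A x -> g (f x) = x.
  move=> Ax; rewrite /g; case: pselect => [e|[]]; last by exists x.
  by case: (cid2 e) => z /= Az; apply: fA.1.
exists g; split=> //; first exact: local_iso_inv fA gK.
by move=> _ [x Ax <-]; rewrite gK.
Qed.

Lemma local_iso_isomorphism A f : local_iso A f ->
  exists2 h : restriction A -> restriction (f @` A), isomorphism h &
    forall u, val (h u) = f (val u).
Proof.
move=> fA; have [g [_ gK fK]] := local_iso_inverse fA; set B := f @` A.
have fP x : x \in A -> f x \in B by move=> /set_mem Ax; apply/mem_set; exists x.
have gP y : y \in B -> g y \in A by move=> /set_mem/fK[Ay _]; exact/mem_set.
pose h (u : restriction A) : restriction B :=
  exist (fun z => z \in B) (f (val u)) (fP _ (valP u)).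
pose k (u : restriction B) : restriction A :=
  exist (fun z => z \in A) (g (val u)) (gP _ (valP u)).
exists h => //; split.
  exists k => u; apply: val_inj; rewrite /=.
    by apply: gK; apply/set_mem; apply: (valP u).
  by apply: (fK _ _).2; apply/set_mem; apply: (valP u).
move=> i t /=; rewrite fA.2; last first.
  by move=> _ /mapP[u _ ->]; apply/set_mem; apply: (valP u).
suff -> : map_tuple f (map_tuple val t) = map_tuple val (map_tuple h t) by [].
by apply: val_inj; rewrite /= -!map_comp.
Qed.

Lemma isomorphic_restrictionP A B :
  isomorphic (restriction A) (restriction B) <->
  exists2 f, local_iso A f & f @` A = B.
Proof.
split=> [[f [[f' fK f'K] fR]]|[f fA fAB]].
  pose g x := if pselect (x \in A) is left e
    then val (f (exist (fun z => z \in A) x e)) else x.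
  have gE (u : restriction A) : g (val u) = val (f u).
    case: u => x e; rewrite /g/=; case: pselect => // e'.
    by congr (val (f _)); apply: val_inj.
  have lift x : A x -> exists u : restriction A, val u = x.
    by move=> /mem_set Ax; exists (exist (fun z => z \in A) x Ax).
  exists g; first split.
  - move=> x y /lift[u <-] /lift[v <-]; rewrite !gE => /val_inj fuv.
    by rewrite -(fK u) fuv fK.
  - move=> i t tA.
    have tA' x : x \in (t : seq R) -> x \in A by move=> /tA/mem_set.
    have [t' tE] : exists t' : (ar i).-tuple (restriction A), map_tuple val t' = t.
      have [l lE] : exists l : seq (restriction A), map val l = t.
        move: tA'; elim: (tval t) => [|a l IH] tA'; first by exists [::].
        have [|l' <-] := IH; first by move=> x xl; apply: tA'; rewrite inE xl orbT.
        by exists (exist (fun z => z \in A) a (tA' a (mem_head _ _)) :: l').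
      have ls : size l == ar i by rewrite -(size_map val) lE size_tuple.
      by exists (Tuple ls); apply: val_inj.
    move: (fR i t'); rewrite /= /set_mem/= => H.
    rewrite -tE; rewrite (_ : map_tuple g _ = map_tuple val (map_tuple f t'))//.
    by apply: val_inj; rewrite /= -!map_comp; apply: eq_map => u /=; rewrite gE.
  - apply/seteqP; split=> [_ [x /lift[u <-] <-]|y By].
      by rewrite gE; apply/set_mem; apply: (valP (f u)).
    pose v : restriction B := exist (fun z => z \in B) y (mem_set By).
    exists (val (f' v)); first by apply/set_mem; apply: (valP (f' v)).
    by rewrite gE f'K.
by rewrite -fAB; have [h hI _] := local_iso_isomorphism fA; exists h.
Qed.

Lemma isomorphism_local_iso f : isomorphism f ->
  local_iso setT f /\ f @` setT = setT.
Proof.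
move=> [[g fK gK] fR]; split; first split=> [x y _ _|i t _].
- exact: (can_inj fK).
- exact: fR.
- by apply/seteqP; split=> // y _; exists (g y).
Qed.

End LocalIso.

(** * Restrictions with equal traces on the monomorphic parts *)

Lemma card_seq_uniq (T : eqType) (s : seq T) : uniq s -> [set` s] #= `I_(size s).
Proof.
elim: s => [_|x s IH /= /andP[xs us]].
  rewrite set_nil (_ : `I_0 = set0) ?card_eq00//.
  by apply/seteqP; split.
apply/eq_cardSP; exists x; first by rewrite /= mem_head.
rewrite (_ : _ `\ x = [set` s]); first exact: IH.
apply/seteqP; split=> y /=; rewrite inE; first by case=> /predU1P[->|].
by move=> ys; split; [rewrite ys orbT|move=> yx; rewrite -yx ys in xs].
Qed.

Section Traces.
Context {I : Type} {ar : I -> nat} {R : structure ar}.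
Implicit Types (e h s t : seq R).

Definition seq_iso e h := exists2 f, local_iso [set` e] f & perm_eq (map f e) h.

Lemma seq_iso_trans e h s : seq_iso e h -> seq_iso h s -> seq_iso e s.
Proof.
move=> [f fe ef] [g gh hg]; exists (g \o f).
  apply: local_iso_comp fe gh _ => x /= xe.
  by rewrite -(perm_mem ef) map_f.
by rewrite map_comp (perm_trans _ hg)// perm_map.
Qed.

Lemma monomorphic_seq_iso (B : set R) e h : monomorphic_part B ->
  uniq e -> uniq h -> size e = size h -> [set` e] `\` B = [set` h] `\` B ->
  seq_iso e h.
Proof.
move=> mB ue uh eh eBh.
have /isomorphic_restrictionP[f fe efh] : isomorphic (restriction [set` e]) (restriction [set` h]).
  by apply: (mB (size e)) => //; [|rewrite eh]; exact: card_seq_uniq.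
exists f => //; apply: uniq_perm => //.
  by rewrite map_inj_in_uniq// => x y xe ye; apply: fe.1.
move=> y; apply/idP/idP => [/mapP[x xe ->]|yh].
  by have : [set` h] (f x) by rewrite -efh; exists x.
by have : [set` h] y by []; rewrite -efh => -[x xe <-]; apply: map_f.
Qed.

Variables (lab : R -> nat) (M : nat).
Hypothesis lab_lt : forall x, lab x < M.
Hypothesis lab_mono : forall l, monomorphic_part [set x | lab x = l].

(** A monomorphic part allows changing a set inside one part only, so e is
    turned into h label by label: the intermediate set agrees with h on the
    labels below l and with e on the others. *)
Lemma trace_seq_iso e h : uniq e -> uniq h ->
  perm_eq (map lab e) (map lab h) -> seq_iso e h.
Proof.
move=> ue uh eh.
pose H l := [seq x <- h | lab x < l] ++ [seq x <- e | l <= lab x].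
have HE l x : (x \in H l) = if lab x < l then x \in h else x \in e.
  by rewrite mem_cat !mem_filter ltnNge; case: leqP; rewrite /= ?orbF.
have Hu l : uniq (H l).
  rewrite cat_uniq !filter_uniq// andbT; apply/hasPn => x.
  by rewrite !mem_filter leqNgt => /andP[/negPf->].
have Hs l : size (H l) = size e.
  rewrite size_cat !size_filter -(count_map lab (fun i => i < l)).
  rewrite -(count_map lab (fun i => l <= i)) -(permP eh) -(size_map lab).
  rewrite -[RHS](count_predC (fun i => i < l)); congr addn.
  by apply: eq_count => i /=; rewrite leqNgt.
have HM : H M = h.
  rewrite /H [X in X ++ _](_ : _ = h).
    rewrite [X in _ ++ X](_ : _ = [::]) ?cats0//.
    by rewrite -(@filter_pred0 _ e); apply: eq_filter => x; rewrite leqNgt lab_lt.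
  by rewrite -[RHS]filter_predT; apply: eq_filter => x; rewrite lab_lt.
suff : seq_iso e (H M) by rewrite HM.
elim: {HM} M => [|l IH].
  rewrite /H [X in X ++ _](_ : _ = [::]); last first.
    by rewrite -(@filter_pred0 _ h); apply: eq_filter.
  exists id; first exact: local_iso_id.
  by rewrite map_id /= (@eq_filter _ _ predT)// filter_predT.
apply: seq_iso_trans IH _; apply: (monomorphic_seq_iso (lab_mono (l := l))) => //.
  by rewrite !Hs.
have E x : lab x <> l -> (lab x < l.+1) = (lab x < l).
  by move=> /eqP/negPf xl; rewrite ltnS leq_eqVlt xl.
by apply/seteqP; split=> x /= [+ xl]; rewrite !HE E.
Qed.

End Traces.

(** * Ultrafilters and generic sequences *)

Lemma ultrafilterP (T : Type) (F : set_system T) : ProperFilter F ->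
  (forall A, F A \/ F (~` A)) -> UltraFilter F.
Proof.
move=> FF Fdec; split=> // G GG FG; apply/seteqP; split=> // A GA.
have [//|/FG GnA] := Fdec A; exfalso.
by apply: (@filter_not_empty _ G _); rewrite -(setICr A); exact: filterI.
Qed.

Lemma filter_forall_seq (T : Type) (K : eqType) (F : set_system T) (r : seq K)
    (Q : K -> set T) : Filter F -> (forall k, k \in r -> F (Q k)) ->
  F [set x | forall k, k \in r -> Q k x].
Proof.
move=> FF; elim: r => [|k r IH] H; first by apply: (@filterS _ F _ setT) => //; exact: filterT.
apply: (@filterS2 _ F _ _ _ _ _ (H k (mem_head _ _)) (IH _)) => [x Qk Qr k'|k' k'r].
  by rewrite inE => /predU1P[->|/Qr].
by apply: H; rewrite inE k'r orbT.
Qed.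

Lemma ultra_some (T : Type) (K : eqType) (F : set_system T) (r : seq K)
    (Q : K -> set T) : UltraFilter F -> F [set x | exists2 k, k \in r & Q k x] ->
  exists2 k, k \in r & F (Q k).
Proof.
move=> FF FQ; apply: contrapT => N.
have /filter_forall_seq : forall k, k \in r -> F (~` Q k).
  by move=> k kr; have [Fk|//] := in_ultra_setVsetC (Q k) FF; case: N; exists k.
move=> /(filterI FQ)/filter_ex[x [[k kr Qk] /(_ _ kr)]]; exact.
Qed.

Section Generic.
Variables (T : eqType) (U : nat -> set_system T).
Hypothesis ultraU : forall l, UltraFilter (U l).
Implicit Types (v : seq nat) (s : seq T) (P Q : set (seq T)).

(** The tensor product of the ultrafilters U l for l in v: it tells whether P
    holds for a sequence whose entries are chosen one after the other,
    generically with respect to these ultrafilters. *)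
Fixpoint generic v : set_system (seq T) :=
  if v is l :: v'
  then [set P | U l [set x | generic v' [set s | P (x :: s)]]]
  else [set P | P [::]].

Lemma ultra_generic v : UltraFilter (generic v).
Proof.
elim: v => [|l v IH].
  apply: ultrafilterP => [|P]; last exact: EM.
  by apply: Build_ProperFilter_ex => [P P0|]; [exists [::]|split=> // P Q PQ /PQ].
apply: ultrafilterP => [|P].
  apply: Build_ProperFilter_ex => [P|].
    move=> G; have [x Gx] := @filter_ex _ (U l) _ _ G.
    by have [s Ps] := @filter_ex _ (generic v) _ _ Gx; exists (x :: s).
  split=> [|P Q|P Q PQ] /=.
  - by apply: (@filterS _ (U l) _ setT) => [x _|]; exact: filterT.
  - by apply: (@filterS2 _ (U l)) => x; exact: filterI.
  - apply: (@filterS _ (U l)) => x; apply: (@filterS _ (generic v)) => s; exact: PQ.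
have [|H] := in_ultra_setVsetC [set x | generic v [set s | P (x :: s)]] (ultraU l).
  by left.
right; apply: (@filterS _ (U l)) H => x /= nG.
by case: (in_ultra_setVsetC [set s | P (x :: s)] IH).
Qed.
#[local] Existing Instance ultra_generic.

(** A quantifier over an entry that P does not look at is vacuous; so a
    subsequence of a generic sequence is generic. *)
Lemma generic_mask m v P : size m = size v -> generic (mask m v) P ->
  generic v [set s | P (mask m s)].
Proof.
elim: v m P => [|l v IH] [|[] m] P //= [mv].
  by apply: (@filterS _ (U _)) => x; exact: IH.
move=> G; apply: (@filterS _ (U l) _ setT); last exact: filterT.
by move=> x _; exact: IH.
Qed.

Lemma generic_notin v x : (forall l, l \in v -> U l (~` [set x])) ->
  generic v [set s | x \notin s].
Proof.
elim: v => [//|l v IH] H /=.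
apply: (@filterS _ (U _)) (H l (mem_head _ _)) => y /= /eqP yx.
have /IH : forall k, k \in v -> U k (~` [set x]).
  by move=> k kv; apply: H; rewrite inE kv orbT.
by apply: (@filterS _ (generic v)) => s /= xs; rewrite inE eq_sym negb_or yx.
Qed.

Variable lab : T -> nat.

(** The second condition is what makes generic sequences duplicate-free: a
    principal ultrafilter may serve a label only once. *)
Definition realizable v :=
  (forall l, l \in v -> U l [set x | lab x = l]) /\
  (forall l, l \in v -> 1 < count_mem l v -> forall x, U l (~` [set x])).

Lemma realizable_mask m v : realizable v -> realizable (mask m v).
Proof.
move=> [v1 v2]; split=> [l /mem_mask/v1//|l /mem_mask/v2 H c].
apply: H; apply: leq_trans c _; apply: leq_count_subseq; exact: mask_subseq.
Qed.

Lemma generic_lab v : realizable v -> generic v [set s | map lab s = v].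
Proof.
move=> [+ _]; elim: v => [//|l v IH] H /=.
apply: (@filterS _ (U _)) (H l (mem_head _ _)) => x /= <-.
have /IH : forall k, k \in v -> U k [set x | lab x = k].
  by move=> k kv; apply: H; rewrite inE kv orbT.
by apply: (@filterS _ (generic v)) => s /= ->.
Qed.

Lemma generic_uniq v : realizable v -> generic v [set s | uniq s].
Proof.
elim: v => [//|l v IH] [H1 H2] /=.
apply: (@filterS _ (U _)) (H1 l (mem_head _ _)) => x /= xl.
apply: (@filterS2 _ (generic v) _ _ _ _ _ (generic_notin (x := x) _) (IH _)).
- by move=> s /= -> ->.
- move=> k kv; have [kl|kl] := eqVneq k l.
    apply: (H2 k); rewrite ?inE ?kv ?orbT//= kl eqxx ltnS -has_count has_pred1.
    by rewrite -kl.
  apply: (@filterS _ (U k) _ [set x | lab x = k]); last by apply: H1; rewrite inE kv orbT.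
  by move=> y /= yk yx; rewrite -yk yx xl eqxx in kl.
- split=> k kv; first by apply: H1; rewrite inE kv orbT.
  move=> c; apply: H2; rewrite ?inE ?kv ?orbT//=.
  by apply: leq_trans c _; rewrite leq_addl.
Qed.

End Generic.

Section Indiscernible.
Context {I : Type} {ar : I -> nat} {R : structure ar}.
Variables (lab : R -> nat) (M : nat).
Hypothesis lab_lt : forall x, lab x < M.
Hypothesis lab_mono : forall l, monomorphic_part [set x | lab x = l].
Variable U : nat -> set_system R.
Hypothesis ultraU : forall l, UltraFilter (U l).

(** The matching of s and t position by position is a local isomorphism, as for
    tuples with the same quantifier-free type. *)
Definition same_type (s t : seq R) := exists2 f, local_iso [set` s] f & map f s = t.

Lemma same_type_trans s t u : same_type s t -> same_type t u -> same_type s u.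
Proof.
move=> [f fs <-] [g gs <-]; exists (g \o f); last by rewrite map_comp.
by apply: local_iso_comp fs gs _ => x xs; apply: map_f.
Qed.

Lemma same_type_sym s t : same_type s t -> same_type t s.
Proof.
move=> [f fs <-]; have [g [gs gK fK]] := local_iso_inverse fs.
exists g; last by rewrite -map_comp -[RHS]map_id; apply/eq_in_map => x /gK.
by apply: local_iso_sub gs => _ /mapP[x xs ->]; exists x.
Qed.

(** All duplicate-free sequences labelled by v enumerate isomorphic
    restrictions, so each has the type of some permutation of a fixed one; of
    these finitely many types the ultrafilter selects one. *)
Lemma generic_type v : realizable U lab v ->
  exists t, generic U v [set s | same_type s t].
Proof.
move=> rv; have GU := ultra_generic ultraU v.
have Gv : generic U v ([set s | uniq s] `&` [set s | map lab s = v]).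
  exact: (@filterI _ (generic U v) _ _ _ (generic_uniq ultraU rv) (generic_lab ultraU rv)).
have [a [/= ua la]] := filter_ex Gv.
have : generic U v [set s | exists2 t, t \in permutations a & same_type s t].
  apply: (@filterS _ (generic U v)) Gv => s [/= us ls].
  have [|f fs sfa] := trace_seq_iso lab_lt lab_mono us ua; first by rewrite la ls.
  by exists (map f s); [rewrite mem_permutations|exists f].
by move=> /ultra_some[t _ Gt]; exists t.
Qed.

(** By [generic_type] the type of a generic subsequence depends only on its
    labels.  A sequence has finitely many subsequences, so one h behaves
    generically for all of them at once. *)
Lemma indiscernible_seq w : realizable U lab w ->
  exists h, [/\ uniq h, map lab h = w &
    forall m m', size m = size w -> size m' = size w -> mask m w = mask m' w ->
      same_type (mask m h) (mask m' h)].
Proof.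
move=> rw; have GU := ultra_generic ultraU w.
have /choice[t tP] : forall v, exists t : seq R, realizable U lab v ->
    generic U v [set s | same_type s t].
  move=> v.
  have [/generic_type[t]|nv] := pselect (realizable U lab v); last by exists [::].
  by exists t.
pose ms : seq (seq bool) := map val (enum {: (size w).-tuple bool}).
have /filter_forall_seq : forall m, m \in ms ->
    generic U w [set s | same_type (mask m s) (t (mask m w))].
  move=> _ /mapP[m _ ->].
  apply: (@generic_mask _ _ ultraU _ _ [set s | same_type s (t (mask m w))]).
    by rewrite size_tuple.
  exact/tP/realizable_mask.
move=> /(filterI (generic_uniq ultraU rw)).
move=> /(filterI (generic_lab ultraU rw)) /filter_ex.
move=> [h [/= hw [/= uh H]]]; exists h; split=> // m m' sm sm' mm'.
have inl b : size b = size w -> b \in ms.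
  by move=> /eqP sb; apply/mapP; exists (Tuple sb); rewrite ?mem_enum.
apply: same_type_trans (H m (inl _ sm)) _; rewrite mm'.
exact/same_type_sym/H/inl.
Qed.

End Indiscernible.

(** * Linear orders that control the structure *)

Lemma sorted_index (T : eqType) (h : seq T) : uniq h ->
  sorted (fun u v => index u h < index v h) h.
Proof.
case: h => [//|x0 h'] uh; set h := x0 :: h'.
rewrite -[sorted _ _](@sorted_map _ _ (index^~ h) ltn).
rewrite (_ : map _ h = iota 0 (size h)) ?iota_ltn_sorted//.
apply: (@eq_from_nth _ 0); first by rewrite size_map size_iota.
move=> i; rewrite size_map => ih.
by rewrite (nth_map x0)// nth_iota// index_uniq.
Qed.

Section FiniteChain.
Context {I : Type} {ar : I -> nat} {R : structure ar}.
Variables (lab : R -> nat) (M : nat).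
Hypothesis lab_lt : forall x, lab x < M.
Hypothesis lab_mono : forall l, monomorphic_part [set x | lab x = l].
Variable U : nat -> set_system R.
Hypothesis ultraU : forall l, UltraFilter (U l).
Hypothesis U_lab : forall x, U (lab x) [set y | lab y = lab x].
Hypothesis U_free : forall x y, x <> y -> lab x = lab y ->
  forall z, U (lab x) (~` [set z]).

Lemma realizable_lab (e : seq R) : uniq e -> realizable U lab (map lab e).
Proof.
move=> ue; split=> [_ /mapP[x _ ->]|l _]; first exact: U_lab.
rewrite count_map -size_filter.
have := filter_uniq (preim lab (pred1 l)) ue.
case E : [seq x <- e | _] => [|x [|y r]]//= + _ z.
rewrite inE negb_or => /andP[/andP[/eqP xy _] _].
have lx : lab x = l.
  have : x \in x :: y :: r by rewrite mem_head.
  by rewrite -E mem_filter => /andP[/eqP].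
have ly : lab y = l.
  have : y \in x :: y :: r by rewrite !inE eqxx orbT.
  by rewrite -E mem_filter => /andP[/eqP].
by rewrite -lx; apply: (U_free xy); rewrite lx.
Qed.

Definition chains (e : set R) (pos lb : R -> nat) : Prop :=
  forall (A : set R) f, A `<=` e -> (forall x, A x -> e (f x)) ->
    (forall x, A x -> lb (f x) = lb x) ->
    (forall x y, A x -> A y -> lb x = lb y -> pos x < pos y -> pos (f x) < pos (f y)) ->
    local_iso A f.

(** Sort the labels of e and take an indiscernible sequence h with these
    labels.  The restriction to e is isomorphic to the restriction to h, along
    which the positions and the labels of h are pulled back.  As the labels of
    h increase, an increasing map that preserves labels sends a subsequence of
    h to a subsequence with the same labels. *)
Lemma finite_chain (e : seq R) : uniq e ->
  exists2 pl : (R -> nat) * (R -> nat), chains [set` e] pl.1 pl.2 &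
    (forall x, pl.2 x < M) /\
    (forall x y, x \in e -> y \in e -> pl.1 x = pl.1 y -> x = y).
Proof.
move=> ue.
pose w := sort leq (map lab e).
have pw : perm_eq w (map lab e) by rewrite perm_sort.
have rw : realizable U lab w.
  have [r1 r2] := realizable_lab ue; split=> l; rewrite (perm_mem pw) => lw.
    exact: r1.
  by rewrite (permP pw); apply: r2.
have [h [uh hw hI]] := indiscernible_seq lab_lt lab_mono ultraU rw.
have [|phi phie phih] := trace_seq_iso lab_lt lab_mono ue uh.
  by rewrite hw perm_sym.
have eh x : x \in e -> phi x \in h by move=> xe; rewrite -(perm_mem phih) map_f.
exists (fun x => index (phi x) h, fun x => lab (phi x)) => /=; last first.
  split=> // x y xe ye /(congr1 (nth (phi x) h)); rewrite !nth_index ?eh//.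
  exact: phie.1.
move=> A f Ae fe fl fpos.
have lab_index u v : u \in h -> v \in h -> lab u < lab v -> index u h < index v h.
  move=> uh' vh; apply: contraTT; rewrite -!leqNgt => vu.
  rewrite -(nth_index u uh') -(nth_index u vh) -!(nth_map u 0 lab) ?index_mem//.
  rewrite hw; apply: (sorted_leq_nth leq_trans leqnn) => //.
  - exact/sort_sorted/leq_total.
  - by rewrite inE -hw size_map index_mem.
  - by rewrite inE -hw size_map index_mem.
have [phi' [phi'e phiK _]] := local_iso_inverse phie.
pose a := [seq u <- h | `[< (phi @` A) u >]].
have aE x : A x -> phi x \in a.
  by move=> Ax; rewrite mem_filter eh ?andbT; [apply/asboolP; exists x|exact: Ae].
have aP u : u \in a -> exists2 x, A x & u = phi x.
  by rewrite mem_filter => /andP[/asboolP[x Ax <-] _]; exists x.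
pose g := phi \o f \o phi'.
have gE x : A x -> g (phi x) = phi (f x) by move=> Ax; rewrite /g/= phiK//; exact: Ae.
pose r u v := index u h < index v h.
have rT : transitive r by move=> u v t; exact: ltn_trans.
have sh : sorted r h by apply: sorted_index.
have ag : map g a = [seq u <- h | u \in map g a].
  apply: (@irr_sorted_eq _ r) => //.
  - by move=> u; rewrite /r ltnn.
  - rewrite sorted_map; apply: (@sub_in_sorted _ (mem a) r); last 2 first.
    + by apply/allP.
    + exact: sorted_filter.
    move=> _ _ /aP[x Ax ->] /aP[y Ay ->]; rewrite /r /= !gE//.
    have xe := Ae _ Ax; have ye := Ae _ Ay; have fxe := fe _ Ax; have fye := fe _ Ay.
    have [lxy|lxy|lxy] := ltngtP (lab (phi x)) (lab (phi y)); last exact: fpos.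
      by move=> _; apply: lab_index; rewrite ?eh// !fl.
    by have := lab_index _ _ (eh _ ye) (eh _ xe) lxy; case: ltngtP.
  - exact: sorted_filter.
  - move=> u; rewrite mem_filter andb_idr// => /mapP[_ /aP[x Ax ->] ->].
    by rewrite gE//; apply/eh/fe.
have la : map lab (map g a) = map lab a.
  rewrite -map_comp; apply/eq_in_map => _ /aP[x Ax ->] /=.
  by rewrite gE// fl.
have [f1 f1a f1E] : same_type a (map g a).
  rewrite ag /a !filter_mask; apply: hI; rewrite ?size_map -?hw ?size_map//.
  by rewrite -!map_mask -!filter_mask -ag la.
have ga : local_iso [set` a] g.
  by apply: eq_local_iso f1a; apply/eq_in_map.
apply: (local_iso_cancel phie) => //.
apply: (@eq_local_iso _ _ _ _ (g \o phi)) => [x Ax|]; first by rewrite /= gE.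
apply: local_iso_comp ga _ => [|x /aE//].
exact: local_iso_sub phie.
Qed.

End FiniteChain.

Lemma free_ultrafilter (T : Type) (V : set T) : infinite_set V ->
  exists F : set_system T, [/\ UltraFilter F, F V &
    forall S, finite_set S -> F (~` S)].
Proof.
move=> infV; pose G : set_system T := [set P | finite_set (V `\` P)].
have GG : ProperFilter G.
  apply: Build_ProperFilter_ex => [P GP|].
    apply: contrapT => P0; apply: infV; apply: sub_finite_set GP => x Vx.
    by split=> // Px; apply: P0; exists x.
  split=> [|P Q GP GQ|P Q PQ]; rewrite /G/=.
  - by rewrite setDT; exact: finite_set0.
  - by rewrite setDIr finite_setU.
  - by apply: sub_finite_set => x [Vx nQ]; split=> // /PQ.
have [F [FU GF]] := ultraFilterLemma GG; exists F; split=> // [|S fS]; apply: GF.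
  by rewrite /G /= setDv; exact: finite_set0.
by rewrite /G /= setDE setCK; exact: finite_setIr.
Qed.

Section Multichain.
Context {I : Type} {ar : I -> nat} {R : structure ar}.

(** R is freely interpretable in a sum of finitely many chains, which are the
    label classes ordered by lt. *)
Record multichain (c : R -> nat) (lt : rel R) : Prop := Multichain {
  mc_bounded : exists M, forall x, c x < M;
  mc_irr : irreflexive lt;
  mc_trans : transitive lt;
  mc_total : forall x y, [|| x == y, lt x y | lt y x];
  mc_iso : forall (A : set R) f, (forall x, A x -> c (f x) = c x) ->
    (forall x y, A x -> A y -> c x = c y -> lt x y -> lt (f x) (f y)) ->
    local_iso A f
}.

Lemma multichain_connex (c : R -> nat) (lt : rel R) x y : multichain c lt ->
  x <> y -> lt x y \/ lt y x.
Proof.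
move=> mc /eqP/negPf xy; have := mc_total mc x y; rewrite xy /=.
by case/orP; [left|right].
Qed.

Lemma multichain_asym (c : R -> nat) (lt : rel R) x y : multichain c lt ->
  lt x y -> lt y x -> False.
Proof. by move=> mc xy yx; have := mc_trans mc xy yx; rewrite (mc_irr mc). Qed.

(** A compactness argument: the positions and labels found on an increasing
    sequence of finite sets that exhausts the domain are compared along a free
    ultrafilter on nat. *)
Lemma finite_chains_multichain (M : nat) : countable [set: R] ->
  (forall e : seq R, uniq e ->
    exists2 pl : (R -> nat) * (R -> nat), chains [set` e] pl.1 pl.2 &
    (forall x, pl.2 x < M) /\
    (forall x y, x \in e -> y \in e -> pl.1 x = pl.1 y -> x = y)) ->
  exists c lt, multichain c lt.
Proof.
move=> /countable_injP[code codeI'] fin.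
have codeI x y : code x = code y -> x = y by move=> /codeI'; apply; rewrite inE.
have /choice[pl plP] : forall n, exists pl : (R -> nat) * (R -> nat),
    [/\ chains [set x | code x < n] pl.1 pl.2, forall x, pl.2 x < M &
     forall x y, code x < n -> code y < n -> pl.1 x = pl.1 y -> x = y].
  move=> n.
  have /finite_seqP[e eE] : finite_set [set x | code x < n].
    by apply: (@finite_preimage _ _ `I_n) => // x y _ _; exact: codeI.
  have [] := fin (undup e); first exact: undup_uniq.
  move=> pl; rewrite (_ : [set` undup e] = [set x | code x < n]).
    move=> plc [plM plI]; exists pl; split=> // x y xn yn; apply: plI.
      by have : [set x | code x < n] x by []; rewrite eE/= mem_undup.
    by have : [set x | code x < n] y by []; rewrite eE/= mem_undup.
  by rewrite eE; apply/seteqP; split=> x /=; rewrite mem_undup.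
have [W [WU WT Wfree]] := free_ultrafilter infinite_nat.
have Wge x : W [set n | code x < n].
  apply: (@filterS _ W _ (~` `I_(code x).+1)); last exact/Wfree/finite_II.
  by move=> n /= /negP; rewrite -leqNgt.
pose pos n := (pl n).1; pose lb n := (pl n).2.
have /choice[c cP] : forall x, exists l, W [set n | lb n x = l].
  move=> x; have [|l _ Wl] := @ultra_some _ _ W (iota 0 M) (fun l => [set n | lb n x = l]) WU.
    2: by exists l.
  apply: (@filterS _ W _ setT) => [n _|//]; exists (lb n x) => //.
  by rewrite mem_iota /= add0n; have [_ + _] := plP n; apply.
pose lt x y := `[< W [set n | pos n x < pos n y] >].
have ltP x y : reflect (W [set n | pos n x < pos n y]) (lt x y) by exact: asboolP.
have nlt x y : ~~ lt x y -> W [set n | ~~ (pos n x < pos n y)].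
  move=> /asboolP nW.
  have [//|] := in_ultra_setVsetC [set n | pos n x < pos n y] WU.
  by apply: filterS => n /= /negP.
have posI x y : x <> y -> W [set n | pos n x <> pos n y].
  move=> xy; apply: (@filterS2 _ W) (Wge x) (Wge y) => n /= xn yn.
  by have [_ _ /(_ x y xn yn)H] := plP n => /H.
exists c, lt; split.
- exists M => x; have [n /= <-] := filter_ex (cP x); by have [_ + _] := plP n; apply.
- move=> x; apply/negbTE/asboolPn => /filter_ex[n]; by rewrite /= ltnn.
- move=> y x z /ltP xy /ltP yz; apply/ltP.
  by apply: (@filterS2 _ W) xy yz => n; exact: ltn_trans.
- move=> x y; have [//|/eqP/posI xy] := eqVneq x y.
  have [//|/nlt nxy'] := boolP (lt x y); apply/ltP.
  by apply: (@filterS2 _ W) xy nxy' => n /= /eqP; case: ltngtP.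
move=> A f fc flt; apply: local_iso_finitary => s sA.
pose s2 := s ++ map f s.
have W1 : W [set n | forall x, x \in s2 -> code x < n].
  by apply: (@filter_forall_seq _ _ W s2 (fun x => [set n | code x < n])) => x _; exact: Wge.
have W2 : W [set n | forall x, x \in s2 -> lb n x = c x].
  by apply: (@filter_forall_seq _ _ W s2 (fun x => [set n | lb n x = c x])) => x _; exact: cP.
have W3 : W [set n | forall x, x \in s -> forall y, y \in s -> c x = c y ->
    pos n x < pos n y -> pos n (f x) < pos n (f y)].
  apply: (@filter_forall_seq _ _ W s (fun x => [set n | forall y, y \in s -> c x = c y ->
    pos n x < pos n y -> pos n (f x) < pos n (f y)])) => x xs.
  apply: (@filter_forall_seq _ _ W s (fun y => [set n | c x = c y ->
    pos n x < pos n y -> pos n (f x) < pos n (f y)])) => y ys.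
  have [xy|/nlt] := boolP (lt x y); last first.
    by apply: filterS => n /= /negP.
  have [cxy|cxy] := pselect (c x = c y); last first.
    by apply: (@filterS _ W _ setT) => // n _ /cxy.
  have /ltP : lt (f x) (f y) by apply: flt => //; exact: sA.
  by apply: (@filterS _ W) => n fxy _ _.
have [n [/= n1 [n2 n3]]] := filter_ex (filterI W1 (filterI W2 W3)).
have xs2 x : x \in s -> x \in s2 by move=> xs; rewrite mem_cat xs.
have fs2 x : x \in s -> f x \in s2 by move=> xs; rewrite mem_cat map_f ?orbT.
have [chn _ _] := plP n; apply: chn.
- by move=> x /= /xs2/n1.
- by move=> x /= /fs2/n1.
- move=> x xs; have := n2 _ (fs2 _ xs).
  by rewrite fc; [rewrite -(n2 _ (xs2 _ xs))|exact: sA].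
- move=> x y xs ys lxy; apply: n3 => //.
  by rewrite -(n2 _ (xs2 _ xs)) -(n2 _ (xs2 _ ys)).
Qed.

End Multichain.

Section Decomposition.
Context {I : Type} {ar : I -> nat} {R : structure ar}.

Lemma sub_monomorphic_part (B B' : set R) : B' `<=` B ->
  monomorphic_part B -> monomorphic_part B'.
Proof.
move=> BB mB k A A' cA cA' E; apply: (mB k) => //.
by rewrite -((setUidPr _ _).2 BB) -!setDDl E.
Qed.

(** Finite blocks are split into singletons, as a free ultrafilter exists only
    on an infinite block. *)
Lemma decomposition_labels : has_finite_monomorphic_decomposition R ->
  exists (lab : R -> nat) (M : nat), [/\ forall x, lab x < M,
    forall l, monomorphic_part [set x | lab x = l] &
    forall x y, x <> y -> lab x = lab y -> infinite_set [set z | lab z = lab x]].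
Proof.
move=> [P [/finite_seqP[bl blE] [[cov triv _] mono]]].
have /choice[B BP] : forall x, exists B, P B /\ B x.
  move=> x; have : cover P id x by rewrite cov.
  by move=> [B PB Bx]; exists B.
have Bbl x : B x \in bl by have [] := BP x; rewrite blE.
have B_eq x y : B x y -> B x = B y.
  move=> Bxy; have [Px _] := BP x; have [Py Byy] := BP y.
  by apply: triv => //; exists y.
have /finite_seqP[fs fsE] : finite_set [set x | finite_set (B x)].
  rewrite (_ : mkset _ = \bigcup_(C in P `&` [set C | finite_set C]) C).
    apply: bigcup_finite => [|C []//].
    by apply: finite_setIl; rewrite blE; exact: finite_seq.
  apply/seteqP; split=> [x /= fx|x [C [PC fC] Cx] /=].
    by exists (B x); [split=> //|]; case: (BP x).
  have [Px Bx] := BP x; suff -> : B x = C by [].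
  by apply: triv => //; exists x.
have fsP x : x \in fs = `[< finite_set (B x) >].
  apply/idP/asboolP => [xfs|fx].
    by have : [set` fs] x by []; rewrite -fsE.
  by have : [set x | finite_set (B x)] x by []; rewrite fsE.
pose lab x := if x \in fs then index x fs else size fs + index (B x) bl.
have labE x y : lab x = lab y -> x = y \/ (x \notin fs) /\ B x = B y.
  rewrite /lab; case: ifPn => xfs; case: ifPn => yfs.
  - by move/(congr1 (nth x fs)); rewrite !nth_index//; left.
  - by move=> E; have := xfs; rewrite -index_mem E ltnNge leq_addr.
  - by move=> E; have := yfs; rewrite -index_mem -E ltnNge leq_addr.
  - by move=> /addnI /(congr1 (nth setT bl)); rewrite !nth_index//; right.
exists lab, (size fs + size bl); split.
- move=> x; rewrite /lab; case: ifPn => xfs.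
    by rewrite (leq_trans _ (leq_addr _ _))// index_mem.
  by rewrite ltn_add2l index_mem.
- move=> l; have [[x xl]|nl] := pselect (exists x, lab x = l).
    have [Px Bx] := BP x.
    apply: sub_monomorphic_part (mono _ Px) => y /=; rewrite -xl => /labE[->//|[_ yx]]; rewrite -yx.
    by have [] := BP y.
  move=> k A A' cA cA'; rewrite (_ : mkset _ = set0).
    rewrite !setD0 => ->; apply/isomorphic_restrictionP.
    by exists id; [exact: local_iso_id|rewrite image_id].
  by rewrite -subset0 => x /= xl; apply: nl; exists x.
- move=> x y xy /labE[//|[xfs Bxy]]; have := xfs; rewrite fsP => /asboolP.
  apply: contra_not; apply: sub_finite_set => z /B_eq Bz.
  have zfs : z \notin fs by rewrite fsP -Bz -fsP.
  by rewrite /= /lab (negPf xfs) (negPf zfs) Bz.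
Qed.

Theorem decomposition_multichain : countable [set: R] ->
  has_finite_monomorphic_decomposition R -> exists c lt, multichain (R := R) c lt.
Proof.
move=> cR /decomposition_labels[lab [M [labM lab_mono lab_inf]]].
have [[x0 _]|R0] := pselect (exists x : R, True); last first.
  exists (fun=> 0), (fun _ _ => false); split=> //.
  - by exists 1.
  - by move=> x; case: R0; exists x.
  - move=> A f _ _; apply: eq_local_iso (local_iso_id A) => x; by case: R0; exists x.
have /choice[U UP] : forall l, exists U : set_system R, [/\ UltraFilter U,
    forall x, lab x = l -> U [set y | lab y = l] &
    forall x y, x <> y -> lab x = lab y -> lab x = l -> forall z, U (~` [set z])].
  move=> l; have [inf|fin] := pselect (infinite_set [set y | lab y = l]).
    have [U [UU Ul Uf]] := free_ultrafilter inf; exists U; split=> // x y _ _ _ z.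
    exact/Uf/finite_set1.
  have [[x xl]|nl] := pselect (exists x, lab x = l).
    exists (principal_filter x); split; first exact: principal_filter_ultra.
      by move=> y yl; apply/principal_filterP.
    by move=> y z yz lyz yl; case: fin; rewrite -yl; apply: lab_inf lyz.
  exists (principal_filter x0); split; first exact: principal_filter_ultra.
    by move=> x xl; case: nl; exists x.
  by move=> x y _ _ xl; case: nl; exists x.
have uU l : UltraFilter (U l) by case: (UP l).
apply: (finite_chains_multichain (M := M)) => // e ue.
apply: (finite_chain labM lab_mono uU) => //.
  by move=> x; have [_ H _] := UP (lab x); exact: H.
by move=> x y xy lxy; have [_ _ H] := UP (lab x); exact: H xy lxy _.
Qed.

End Decomposition.

(** * Interchangeable points and the case of one sibling *)

Section Exchange.
Context {T : eqType}.
Implicit Types x y z : T.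

Definition exch x y z := if z == x then y else if z == y then x else z.

Lemma exchL x y : exch x y x = y.
Proof. by rewrite /exch eqxx. Qed.

Lemma exchR x y : exch x y y = x.
Proof. by rewrite /exch eqxx; case: eqP. Qed.

Lemma exchD x y z : z <> x -> z <> y -> exch x y z = z.
Proof. by rewrite /exch => /eqP/negPf -> /eqP/negPf ->. Qed.

Lemma exchC x y : exch x y = exch y x.
Proof.
by apply/funext => z; rewrite /exch; do 2!case: eqP => // ->.
Qed.

Lemma exchxx x : exch x x = id.
Proof. by apply/funext => z; rewrite /exch; case: eqP. Qed.

Lemma exchK x y : involutive (exch x y).
Proof.
move=> z; have [->|zx] := pselect (z = x); first by rewrite exchL exchR.
have [->|zy] := pselect (z = y); first by rewrite exchR exchL.
by rewrite !exchD.
Qed.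

Lemma exch_conj (f : T -> T) x y z : (f z = f x -> z = x) -> (f z = f y -> z = y) ->
  exch (f x) (f y) (f z) = f (exch x y z).
Proof.
move=> zx zy; have [->|/eqP nzx] := eqVneq z x; first by rewrite !exchL.
have [->|/eqP nzy] := eqVneq z y; first by rewrite !exchR.
by rewrite exchD; [rewrite exchD|move/zx|move/zy].
Qed.

Lemma exch_braid x y z : x <> z -> y <> z -> exch x y \o exch y z \o exch x y = exch x z.
Proof.
move=> xz yz; apply/funext => u /=.
have [->|xy] := pselect (x = y); first by rewrite !exchxx.
have [->|ux] := pselect (u = x); first by rewrite !exchL exchD//; apply/nesym.
have [->|uy] := pselect (u = y).
  by rewrite exchR (@exchD y z x)// exchL exchD//; apply/nesym.
have [->|uz] := pselect (u = z).
  by rewrite exchR (@exchD x y z) ?exchR//; apply/nesym.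
by rewrite (@exchD x y u)// (@exchD y z u)// !exchD.
Qed.
End Exchange.

Lemma card_eq_set_bij (T U : Type) (u : U) (A : set T) (B : set U) :
  A #= B -> exists f : T -> U, set_bij A B f.
Proof.
pose Uc : Type := U.
pose PU : pointedType := HB.pack Uc (gen_eqMixin Uc) (gen_choiceMixin Uc) (isPointed.Build Uc u).
by move=> /(@card_set_bijP T PU A B)[f fP]; exists f.
Qed.

Lemma infinite_countable_card_eq (T : Type) (A B : set T) :
  countable [set: T] -> infinite_set A -> infinite_set B -> A #= B.
Proof.
move=> cT; have cS (C : set T) : infinite_set C -> C #= [set: nat].
  by apply: eq_card_nat; apply: sub_countable cT; exact: card_leT.
by move=> /cS iA /cS iB; rewrite (card_eq_trans iA)// card_esym.
Qed.

Lemma finite_bigcup_labels (T : Type) (M : nat) (F : nat -> set T) :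
  (forall l, finite_set (F l)) -> finite_set (\bigcup_(l in `I_M) F l).
Proof. by move=> H; apply: bigcup_finite => //; exact: finite_II. Qed.

Lemma finite_fibers (T : Type) (c : T -> nat) (M : nat) : (forall x, c x < M) ->
  finite_set [set x | finite_set [set z | c z = c x]].
Proof.
move=> c_lt; apply: (@sub_finite_set _ _ (\bigcup_(l in `I_M)
    [set x | c x = l /\ finite_set [set z | c z = l]])).
  by move=> x fx; exists (c x) => //=; exact: c_lt.
apply: finite_bigcup_labels => l.
have [fl|nl] := pselect (finite_set [set z | c z = l]).
  by apply: sub_finite_set fl => x [].
by rewrite (_ : mkset _ = set0); [exact: finite_set0|rewrite -subset0 => x []].
Qed.

Section Interchangeable.
Context {I : Type} {ar : I -> nat} {R : structure ar}.
Implicit Types (A : set R) (f g : R -> R).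

Definition interchangeable (x y : R) := local_iso setT (exch x y).

Lemma interchangeable_refl x : interchangeable x x.
Proof. by rewrite /interchangeable exchxx; exact: local_iso_id. Qed.

Lemma interchangeable_sym x y : interchangeable x y -> interchangeable y x.
Proof. by rewrite /interchangeable exchC. Qed.

Lemma interchangeable_trans x y z :
  interchangeable x y -> interchangeable y z -> interchangeable x z.
Proof.
move=> xy yz; have [->|xz] := pselect (x = z); first exact: interchangeable_refl.
have [<-//|yz'] := pselect (y = z).
rewrite /interchangeable -(@exch_braid _ x y z)//.
by apply: local_iso_comp xy (local_iso_comp yz xy _) _.
Qed.

Lemma interchangeable_reflect f x y : local_iso setT f ->
  interchangeable (f x) (f y) -> interchangeable x y.
Proof.
move=> fR fxy; apply: (local_iso_cancel fR) => //.
apply: eq_local_iso (local_iso_comp fR fxy _) => // z _ /=.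
by rewrite exch_conj//; apply: fR.1.
Qed.

(** On a finite set, g is a product of transpositions of interchangeable points:
    one point after the other is brought back to its place.  In the induction r
    lists the points that are already in place. *)
Lemma interchangeable_local_iso A g : (forall x y, A x -> A y -> g x = g y -> x = y) ->
  (forall x, A x -> interchangeable x (g x)) -> local_iso A g.
Proof.
move=> gI gA; apply: local_iso_finitary => s sA.
suff H s' r h : (forall x, x \in r -> h x = x) ->
    (forall x y, x \in r ++ s' -> y \in r ++ s' -> h x = h y -> x = y) ->
    (forall x, x \in r ++ s' -> interchangeable x (h x)) -> local_iso [set` r ++ s'] h.
  by apply: (H s [::]) => //= [x y xs ys|x xs]; [apply: gI|apply: gA]; apply: sA.
elim: s' r h => [|x s' IH] r h hr hI hint.
  apply: (eq_local_iso _ (local_iso_id _)) => x; rewrite /= cats0 => xr.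
  by rewrite hr.
have xs' : x \in r ++ x :: s' by rewrite mem_cat mem_head orbT.
have hx := hint x xs'.
apply: (@eq_local_iso _ _ _ _ (exch x (h x) \o (exch x (h x) \o h))).
  by move=> z _ /=; rewrite exchK.
apply: local_iso_comp (hx) _ => //.
rewrite -cat_rcons; apply: IH; rewrite ?cat_rcons.
- move=> z; rewrite mem_rcons inE => /predU1P[->|zr] /=; first by rewrite exchR.
  rewrite (hr z zr); have [zx|zx] := pselect (z = x).
    by rewrite -zx (hr z zr) exchxx.
  rewrite exchD// => zhx; apply: zx; apply: hI => //; last by rewrite (hr z zr).
  by rewrite mem_cat zr.
- by move=> y z ys zs /= /(can_inj (exchK _ _)); exact: hI.
- move=> z zs /=; apply: interchangeable_trans (hint z zs) _.
  move: (h z) => w; have [->|wx] := pselect (w = x); first by rewrite exchL.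
  have [->|wh] := pselect (w = h x); first by rewrite exchR; exact: interchangeable_sym.
  by rewrite exchD//; exact: interchangeable_refl.
Qed.

Variables (c : R -> nat) (M : nat).
Hypothesis c_lt : forall x, c x < M.
Hypothesis c_int : forall x y, c x = c y -> infinite_set [set z | c z = c x] ->
  interchangeable x y.
Hypothesis countable_R : countable [set: R].

(** An embedding f reflects interchangeability, so the preimage of a class lies
    in a class.  Each infinite class C has infinitely many points sent to some
    infinite class psi C, and psi is injective on the finitely many infinite
    classes, hence surjective: A has infinitely many points in each.  The finite
    set N of the remaining points is stable under f, because a point of N sent
    to an infinite class would be interchangeable with points of the infinite
    class sent there; so f permutes N and A contains it.  A bijection of R onto
    A that respects the classes is then a local isomorphism. *)
Lemma interchangeable_sibling f A : local_iso setT f -> (forall x, A (f x)) ->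
  exists2 g, local_iso setT g & g @` setT = A.
Proof.
move=> fR fA.
have fI x y : f x = f y -> x = y by apply: fR.1.
have finite_preim S : finite_set S -> finite_set (f @^-1` S).
  by apply: finite_preimage => x y _ _; exact: fI.
pose r x := [set y | interchangeable x y].
have rP x y : r x = r y <-> interchangeable x y.
  split=> [E|xy]; first by suff : r x y by []; rewrite E; exact: interchangeable_refl.
  apply/seteqP; split=> z; last exact: interchangeable_trans.
  exact/interchangeable_trans/interchangeable_sym.
pose inf := [set x | infinite_set [set z | c z = c x]].
pose K : set (set R) := r @` inf.
have Kinf C : K C -> infinite_set [set x | r x = C].
  move=> [x xi <-]; apply: (sub_infinite_set _ xi) => z /= cz; apply/rP.
  by apply: c_int => //; rewrite cz.
have /finite_seqP[Ks' KsE'] : finite_set K.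
  apply: (@sub_finite_set _ _ (\bigcup_(l in `I_M) (r @` (inf `&` [set x | c x = l])))).
    by move=> _ [x xi <-]; exists (c x) => /=; [exact: c_lt|exists x].
  apply: finite_bigcup_labels => l; have [[x [xi xl]]|nl] := pselect (exists x, inf x /\ c x = l).
    apply: sub_finite_set (finite_set1 (r x)) => _ [y [yi yl] <-] /=; apply/rP.
    by apply: c_int => //; rewrite yl xl.
  rewrite (_ : _ @` _ = set0); first exact: finite_set0.
  by rewrite -subset0 => _ [x [xi xl] <-]; apply: nl; exists x.
pose Ks := undup Ks'.
have KsE C : K C <-> C \in Ks by rewrite KsE' mem_undup.
pose N := [set x | ~ K (r x)].
have finN : finite_set N.
  apply: (sub_finite_set _ (finite_fibers c_lt)) => x nK /=.
  by apply: contrapT => xi; apply: nK; exists x.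
have /choice[psi psiP] : forall C, exists C', K C ->
    K C' /\ infinite_set [set x | r x = C /\ r (f x) = C'].
  move=> C; have [KC|] := pselect (K C); last by exists C.
  apply: contrapT => nC; apply: (Kinf _ KC).
  apply: (@sub_finite_set _ _ ((f @^-1` N) `|`
     \bigcup_(C' in K) [set x | r x = C /\ r (f x) = C'])).
    move=> x /= xC; have [Kf|] := pselect (K (r (f x))); last by left.
    by right; exists (r (f x)).
  rewrite finite_setU; split; first exact: finite_preim.
  apply: bigcup_finite => [|C' KC']; first by rewrite KsE'; exact: finite_seq.
  by apply: contrapT => inf'; apply: nC; exists C'.
have f_refl x y : r (f x) = r (f y) -> r x = r y.
  by move=> /rP fxy; apply/rP; exact: interchangeable_reflect fR fxy.
have psi_surj C' : K C' -> exists2 C, K C & psi C = C'.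
  have psiI : {in Ks &, injective psi}.
    move=> C1 C2 /KsE/psiP[_ i1] /KsE/psiP[_ i2] E.
    have [x [xC1 fx]] := infinite_setN0 i1; have [y [yC2 fy]] := infinite_setN0 i2.
    by rewrite -xC1 -yC2; apply: f_refl; rewrite fx fy.
  have [|||_ sub] := @uniq_min_size _ (map psi Ks) Ks; rewrite ?size_map//.
  - by rewrite map_inj_in_uniq// undup_uniq.
  - by move=> _ /mapP[C /KsE/psiP[KC _] ->]; apply/KsE.
  by move=> /KsE; rewrite -sub => /mapP[C /KsE KC ->]; exists C.
have KA C : K C -> infinite_set (A `&` [set x | r x = C]).
  move=> /psi_surj[C1 KC1 <-] fin; have [_] := psiP _ KC1; apply.
  by apply: sub_finite_set (finite_preim _ fin) => x [xC fx] /=; split.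
have fN x : N x -> N (f x).
  move=> Nx Kf; apply: Nx; have [C KC CE] := psi_surj _ Kf.
  have [_ /infinite_setN0[y [yC fy]]] := psiP _ KC.
  by rewrite (f_refl x y) ?yC// fy CE.
have NA x : N x -> A x.
  have /finite_seqP[ns' nsE] := finN; pose ns := undup ns'.
  have nsP z : N z <-> z \in ns by rewrite nsE mem_undup.
  have [|||_ sub] := @uniq_min_size _ (map f ns) ns; rewrite ?size_map//.
  - by rewrite map_inj_uniq ?undup_uniq// => u v; exact: fI.
  - by move=> _ /mapP[z /nsP Nz ->]; apply/nsP/fN.
  by move=> /nsP; rewrite -sub => /mapP[z _ ->].
have /choice[h hP] : forall C, exists h : R -> R, K C ->
    set_bij [set x | r x = C] (A `&` [set x | r x = C]) h.
  move=> C; have [KC|] := pselect (K C); last by exists id.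
  have [x _] := infinite_setN0 (Kinf _ KC).
  have [|h hP] := @card_eq_set_bij _ _ x [set x | r x = C] (A `&` [set x | r x = C]).
    by apply: infinite_countable_card_eq; [exact: countable_R|exact: Kinf|exact: KA].
  by exists h.
pose g x := if pselect (K (r x)) then h (r x) x else x.
have rg x : r (g x) = r x.
  by rewrite /g; case: pselect => // Kx; have [/(_ x erefl)[]] := hP _ Kx.
exists g; first apply: interchangeable_local_iso.
- move=> x y _ _ gxy; have rxy : r x = r y by rewrite -rg gxy rg.
  move: gxy; rewrite /g rxy; case: pselect => // Ky.
  by have [_ hI _] := hP _ Ky; apply: hI; rewrite inE.
- by move=> x _; apply/rP.
apply/seteqP; split=> [_ [x _ <-]|a Aa].
  rewrite /g; case: pselect => [Kx|/NA//].
  by have [/(_ x erefl)[]] := hP _ Kx.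
have [Ka|Na] := pselect (K (r a)).
  have [_ _ /(_ a)[|x /= xa hx]] := hP _ Ka; first by split.
  by exists x => //; rewrite /g xa; case: pselect.
by exists a => //; rewrite /g; case: pselect.
Qed.

End Interchangeable.

(** * Replacing a point by another one of its class *)

Definition room (T : eqType) (n : nat) (W : set T) : Prop :=
  exists s : seq T, [/\ uniq s, size s = n & [set` s] `<=` W].

Lemma room_sub (T : eqType) n m (V W : set T) :
  m <= n -> V `<=` W -> room n V -> room m W.
Proof.
move=> mn VW [s [us sn sV]]; exists (take m s); split.
- exact: take_uniq.
- by rewrite size_takel ?sn.
- by move=> x /= /mem_take/sV/VW.
Qed.

Lemma infinite_room (T : choiceType) n (W : set T) : infinite_set W -> room n W.
Proof.
move=> /(infinite_set_fset n)[X XW Xn].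
apply: (@room_sub T (size (finmap.enum_fset X)) _ W) => //.
by exists (finmap.enum_fset X); split=> //; exact: finmap.fset_uniq.
Qed.

Lemma ltn_count (T : eqType) (P Q : pred T) (s : seq T) z : subpred P Q ->
  z \in s -> Q z -> ~~ P z -> count P s < count Q s.
Proof.
move=> PQ + Qz nPz; elim: s => [//|x s IH]; rewrite inE /= => /predU1P[<-|zs].
  by rewrite Qz (negPf nPz) add0n add1n ltnS sub_count.
apply: (@leq_ltn_trans (Q x + count P s)); last by rewrite ltn_add2l IH.
by rewrite leq_add2r; case Px: (P x); rewrite // (PQ _ Px).
Qed.

Section Replaceable.
Context {I : Type} {ar : I -> nat} {R : structure ar}.

(** On D minus y the transposition just substitutes y for x.  For a
    linear order it means that no point of D lies strictly between x and y. *)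
Definition replaceable (D : set R) (x y : R) := local_iso (D `\ y) (exch x y).

Lemma replaceable_sym D x y : D x -> D y -> replaceable D x y -> replaceable D y x.
Proof.
move=> Dx Dy xy; rewrite /replaceable exchC.
apply: local_iso_sub (local_iso_inv xy (fun z _ => exchK x y z)) => z [/= Dz zx].
exists (exch x y z); last by rewrite exchK.
have [zy|zy] := pselect (z = y); last by rewrite exchD.
by rewrite zy exchR; split=> //= yx; apply: zx; rewrite zy yx.
Qed.

Lemma interchangeable_replaceable D x y : interchangeable x y -> replaceable D x y.
Proof. exact: local_iso_sub. Qed.

Lemma replaceable_map (D : set R) (f : R -> R) (x y : R) : local_iso D f ->
  D x -> D y -> replaceable D x y -> replaceable (f @` D) (f x) (f y).
Proof.
move=> fR Dx Dy xy; have [g [gR gK fK]] := local_iso_inverse fR.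
apply: (@eq_local_iso _ _ _ _ (f \o (exch x y \o g))) => [_ [[z Dz <-] _] /=|].
  by rewrite gK// exch_conj// => /fR.1; apply.
have exchD' z : D z -> D (exch x y z).
  by rewrite /exch; case: ifP => // _; case: ifP.
apply: (local_iso_comp (B := D) _ fR) => [|z [/fK[Dgz _] _]]; last exact: exchD'.
apply: local_iso_comp (local_iso_sub _ gR) xy _ => z []// [u Du <-] /= fuy.
by rewrite gK//; split=> // uy; apply: fuy; rewrite uy.
Qed.

End Replaceable.

Section Chains.
Context {I : Type} {ar : I -> nat} {R : structure ar}.
Variables (c : R -> nat) (lt : rel R).
Hypothesis mc : multichain c lt.

Let ltxx x : lt x x = false. Proof. exact: (mc_irr mc). Qed.
Let lt_trans : transitive lt. Proof. exact: (mc_trans mc). Qed.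
Let lt_total x y : x <> y -> lt x y \/ lt y x. Proof. exact: (multichain_connex mc). Qed.
Let lt_asym x y : lt x y -> lt y x -> False. Proof. exact: (multichain_asym mc). Qed.
Let lt_neq x y : lt x y -> x <> y.
Proof. by move=> xy E; move: xy; rewrite E ltxx. Qed.

Lemma sorted_listing (s : seq R) : uniq s -> exists2 s', perm_eq s' s & sorted lt s'.
Proof.
move=> us; pose le x y := (x == y) || lt x y.
have le_total : total le.
  by move=> x y; have := mc_total mc x y; rewrite /le orbCA => /or3P[]->; rewrite ?orbT.
exists (sort le s); first by rewrite perm_sort.
have := sort_sorted le_total s; have : uniq (sort le s) by rewrite sort_uniq.
case: (sort le s) => [//|x r]; elim: r x => [//|y r IH] x /= /andP[xyr yr] /andP[xy r'].
have /= -> := IH y yr r'; rewrite andbT; move: xy => /predU1P[xy|//].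
by rewrite xy mem_head in xyr.
Qed.

(** The point of rank k in s goes to the point of rank k in a listing of W. *)
Lemma monotone_into (s : seq R) (W : set R) : room (size s) W ->
  exists2 g : R -> R, (forall x, x \in s -> W (g x)) &
    (forall x y, x \in s -> y \in s -> lt x y -> lt (g x) (g y)).
Proof.
move=> roomW.
have [w [uw sw wW]] : room (size (undup s)) W.
  by apply: room_sub roomW => //; exact: size_undup.
have [s' ps' ss'] := sorted_listing (undup_uniq s).
have [w' pw' sw'] := sorted_listing uw.
have in_s' x : (x \in s') = (x \in s) by rewrite (perm_mem ps') mem_undup.
have size_w' : size w' = size s' by rewrite (perm_size pw') sw (perm_size ps').
exists (fun x => nth x w' (index x s')) => [x xs|x y xs ys xy].
  by apply: wW; rewrite /= -(perm_mem pw') mem_nth// size_w' index_mem in_s'.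
have xl : index x s' < size w' by rewrite size_w' index_mem in_s'.
have yl : index y s' < size w' by rewrite size_w' index_mem in_s'.
rewrite (set_nth_default y x)//.
apply: (sorted_ltn_nth lt_trans) => //.
have [//|yx|E] := ltngtP (index x s') (index y s').
  have := sorted_ltn_index lt_trans ss' y x; rewrite !in_s' => /(_ ys xs yx).
  by move=> /(lt_asym xy).
move: (congr1 (nth x s') E); rewrite !nth_index ?in_s'// => E'.
by rewrite E' ltxx in xy.
Qed.

(** Spreads a finite set along the class of label j: the points a and b go to
    the prescribed u and v, the points below a go below u, the points above b
    go above v, and eps moves the other classes.  The case a = b serves to
    control the image of a single point. *)
Lemma fiber_fit (j : nat) (D : set R) (eps : R -> R) (s : seq R) (a b u v : R) :
  (forall x, c (eps x) = c x) ->
  (forall x y, c x = c y -> lt x y -> lt (eps x) (eps y)) ->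
  c a = j -> c b = j -> c u = j -> c v = j -> D u -> D v ->
  a \in s -> b \in s ->
  (a = b /\ u = v) \/ [/\ lt a b, lt u v &
    forall x, x \in s -> c x = j -> lt a x -> lt x b -> False] ->
  room (size s) [set z | [/\ D z, c z = j & lt z u]] ->
  room (size s) [set z | [/\ D z, c z = j & lt v z]] ->
  exists f : R -> R, [/\ f a = u, f b = v,
    forall x, x \in s -> c (f x) = c x /\ (c x = j -> D (f x)),
    forall x y, x \in s -> y \in s -> c x = c y -> lt x y -> lt (f x) (f y) &
    forall x, c x <> j -> f x = eps x].
Proof.
move=> epsc epslt caj cbj cuj cvj Du Dv sa sb ab.
move=> /monotone_into[g1 g1W g1lt] /monotone_into[g2 g2W g2lt].
pose f x := if c x != j then eps x else if lt x a then g1 x else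
  if x == a then u else if lt b x then g2 x else v.
have leuv : u = v \/ lt u v by case: ab => [[_]|[]]; [left|right].
have leab : a = b \/ lt a b by case: ab => [[]|[]]; [left|right].
have cases x : x \in s -> c x = j -> [\/ lt x a, x = a, x = b | lt b x].
  move=> xs xj; have [->|xa] := pselect (x = a); first by constructor 2.
  have [->|xb] := pselect (x = b); first by constructor 3.
  have [|ax] := lt_total xa; first by constructor 1.
  have [xb'|] := lt_total xb; last by constructor 4.
  case: ab => [[E _]|[_ _ /(_ x xs xj ax xb')//]].
  by move: xb'; rewrite -E => /(lt_asym ax).
have f1 x : c x = j -> lt x a -> f x = g1 x by rewrite /f => -> ->; rewrite eqxx.
have fa : f a = u by rewrite /f caj eqxx ltxx eqxx.
have fb : f b = v.
  rewrite /f cbj eqxx ltxx; case: ab => [[-> ->]|[ab _ _]]; first by rewrite ltxx eqxx.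
  case: ifP => [/(lt_asym ab)//|_]; case: eqP => // ba.
  by move: ab; rewrite ba ltxx.
have f2 x : c x = j -> lt b x -> f x = g2 x.
  move=> xj bx; rewrite /f xj eqxx bx /=.
  have ax : lt a x by case: leab => [->//|ab']; exact: lt_trans bx.
  by case: ifP => [/(lt_asym ax)//|_]; case: eqP => // xa; move: ax; rewrite xa ltxx.
have fe x : c x <> j -> f x = eps x by move=> /eqP xj; rewrite /f xj.
exists f; split=> //.
  move=> x xs; have [xj|xj] := pselect (c x = j); last first.
    by rewrite fe.
  rewrite xj; have [xa|->|->|bx] := cases x xs xj; rewrite ?fa ?fb//.
    by rewrite f1//; have [] := g1W _ xs.
  by rewrite f2//; have [] := g2W _ xs.
move=> x y xs ys cxy xy; have [xj|xj] := pselect (c x = j); last first.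
  by rewrite !fe -?cxy//; exact: epslt.
have yj : c y = j by rewrite -cxy.
have g1u z : z \in s -> lt (g1 z) u by move=> /g1W[].
have g2v z : z \in s -> lt v (g2 z) by move=> /g2W[].
have g1v z : z \in s -> lt (g1 z) v.
  by move=> /g1u; case: leuv => [<-//|uv] /lt_trans; apply.
have g2u z : z \in s -> lt u (g2 z).
  by move=> /g2v; case: leuv => [->//|uv]; exact: lt_trans.
have lea z : lt b z -> lt z a -> False.
  move=> bz za; have := lt_trans bz za; case: leab => [->|]; first by rewrite ltxx.
  exact: lt_asym.
have nba : lt b a -> False by case: leab => [->|]; [rewrite ltxx|exact: lt_asym].
have [xa|xE|xE|bx] := cases x xs xj.
- rewrite (f1 x)//; have [ya|->|->|yb] := cases y ys yj; rewrite ?fa ?fb; auto.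
    by rewrite f1//; apply: g1lt.
  by rewrite f2//; apply: lt_trans (g1v _ xs) (g2v _ ys).
- have [ya|yE|yE|yb] := cases y ys yj.
  + by move: xy; rewrite xE => /(lt_asym ya).
  + by move: xy; rewrite xE yE ltxx.
  + rewrite xE yE fa fb; case: ab => [[ab _]|[]//].
    by move: xy; rewrite xE yE ab ltxx.
  + by rewrite xE fa f2//; apply: g2u.
- have [ya|yE|yE|yb] := cases y ys yj.
  + by case: (lea y) => //; rewrite -xE.
  + by case: nba; rewrite -xE -yE.
  + by move: xy; rewrite xE yE ltxx.
  + by rewrite xE fb f2//; apply: g2v.
have [ya|yE|yE|yb] := cases y ys yj.
- by case: (lea x bx); exact: lt_trans ya.
- by case: (lea x bx); rewrite -yE.
- by move: xy; rewrite yE => /(lt_asym bx).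
- by rewrite !f2//; apply: g2lt.
Qed.

(** Let a < b be neighbours in the class, relative to a finite set s.  Move s
    so that a, b become u, z with u < z < v, the rest of the class staying
    outside the interval from u to v.  Replacing u by v turns the images u, z of
    a, b into v, z, which is how an order-preserving map places b, a: so the
    transposition of a and b is a local isomorphism on s.  Transpositions of
    neighbours generate all the others by conjugation. *)
Lemma exch_fiber (j : nat) (D : set R) (eps : R -> R) :
  (forall x, D (eps x)) -> (forall x, c (eps x) = c x) ->
  (forall x y, c x = c y -> lt x y -> lt (eps x) (eps y)) ->
  (forall n, exists u z v, [/\ D u, D z & D v] /\ [/\ c u = j, c z = j & c v = j] /\
    [/\ lt u z, lt z v & replaceable D u v] /\
    room n [set w | [/\ D w, c w = j & lt w u]] /\
    room n [set w | [/\ D w, c w = j & lt v w]]) ->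
  forall a b, c a = j -> c b = j -> interchangeable a b.
Proof.
move=> epsD epsc epslt far.
suff main (s : seq R) a b : c a = j -> c b = j -> a \in s -> b \in s -> lt a b ->
    local_iso [set` s] (exch a b).
  have lt_int a b : c a = j -> c b = j -> lt a b -> interchangeable a b.
    move=> aj bj ab; apply: local_iso_finitary => s _.
    apply: (@local_iso_sub _ _ _ _ [set` [:: a, b & s]]) => [x /= xs|].
      by rewrite !inE xs !orbT.
    by apply: main; rewrite // !inE eqxx ?orbT.
  move=> a b aj bj; have [->|/lt_total[ab|ba]] := pselect (a = b).
  - exact: interchangeable_refl.
  - exact: lt_int.
  - by apply/interchangeable_sym/lt_int.
(* induction on the number of points of s in the class between a and b *)
pose between a b := count (fun x => [&& c x == j, lt a x & lt x b]) s.
have [n] := ubnP (between a b); elim: n a b => // n IH a b + aj bj sa sb ab.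
rewrite ltnS => btw.
have [[z [zs zj az zb]]|nz] := pselect (exists z, [/\ z \in s, c z = j, lt a z & lt z b]).
  have az_lt : between a z < n.
    apply: leq_trans btw; apply: (@ltn_count _ _ _ _ z) => //.
    - by move=> x /and3P[-> ->] /= /lt_trans; apply.
    - by rewrite zj eqxx az zb.
    - by rewrite ltxx !andbF.
  have zb_lt : between z b < n.
    apply: leq_trans btw; apply: (@ltn_count _ _ _ _ z) => //.
    - by move=> x /and3P[-> zx ->]; rewrite (lt_trans az zx).
    - by rewrite zj eqxx az zb.
    - by rewrite ltxx !andbF.
  have iaz := IH a z az_lt aj zj sa zs az; have izb := IH z b zb_lt zj bj zs sb zb.
  have exch_in x y w : x \in s -> y \in s -> w \in s -> exch x y w \in s.
    by rewrite /exch; case: ifP => // _; case: ifP.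
  rewrite -(@exch_braid _ a z b); [|exact: lt_neq..].
  apply: (local_iso_comp iaz (local_iso_comp izb iaz _)) => x; exact: exch_in.
have [u [z [v [[Du Dz Dv] [[uj zj vj] [[uz zv uv] [lo hi]]]]]]] := far (size s).
have [|f [fa fb fcD flt feps]] := fiber_fit epsc epslt aj bj uj vj Du Dv sa sb _ lo hi.
  right; split=> //; first exact: lt_trans zv.
  by move=> x xs xj ax xb; apply: nz; exists x.
have fD x : x \in s -> D (f x) /\ c (f x) = c x.
  move=> xs; have [xc xD] := fcD x xs; split=> //.
  by have [/xD//|xj] := pselect (c x = j); rewrite feps.
have nab : a <> b := lt_neq ab.
have nuz := lt_neq uz; have nzv := lt_neq zv.
have fI x y : x \in s -> y \in s -> f x = f y -> x = y.
  move=> xs ys fxy; have cxy : c x = c y.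
    by have [_ <-] := fD x xs; have [_ <-] := fD y ys; rewrite fxy.
  apply: contrapT => /lt_total[/(flt _ _ xs ys cxy)|].
    by rewrite fxy ltxx.
  by move=> /(flt _ _ ys xs (esym cxy)); rewrite fxy ltxx.
pose f1 x := if x == b then z else f x.
pose f3 x := if x == a then z else f x.
have f1b : f1 b = z by rewrite /f1 eqxx.
have f1D x : x <> b -> f1 x = f x by rewrite /f1 => /eqP/negPf ->.
have f3a : f3 a = z by rewrite /f3 eqxx.
have f3D x : x <> a -> f3 x = f x by rewrite /f3 => /eqP/negPf ->.
have f1_iso : local_iso [set` s] f1.
  apply: (mc_iso mc) => [x /= xs|x y /= xs ys cxy xy].
    by have [->|xb] := pselect (x = b); rewrite ?f1b ?f1D ?bj//; have [] := fD x xs.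
  have [xb|xb] := pselect (x = b); have [yb|yb] := pselect (y = b).
  - by move: xy; rewrite xb yb ltxx.
  - by rewrite xb f1b f1D//; apply: lt_trans zv _; rewrite -fb; apply: flt; rewrite // -xb.
  - rewrite yb f1b f1D//; have [->|xa] := pselect (x = a); first by rewrite fa.
    have [xa'|ax] := lt_total xa; last first.
      by case: nz; exists x; split=> //; [rewrite cxy yb|rewrite -yb].
    by apply: lt_trans uz; rewrite -fa; apply: flt => //; rewrite cxy yb aj.
  - by rewrite !f1D//; exact: flt.
have f3_iso : local_iso [set` s] f3.
  apply: (mc_iso mc) => [x /= xs|x y /= xs ys cxy xy].
    by have [->|xa] := pselect (x = a); rewrite ?f3a ?f3D ?aj//; have [] := fD x xs.
  have [xa|xa] := pselect (x = a); have [ya|ya] := pselect (y = a).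
  - by move: xy; rewrite xa ya ltxx.
  - rewrite xa f3a f3D//; have [->|yb] := pselect (y = b); first by rewrite fb.
    have [yb'|by'] := lt_total yb.
      by case: nz; exists y; split=> //; [rewrite -cxy xa|rewrite -xa].
    by apply: lt_trans zv _; rewrite -fb; apply: flt => //; rewrite -cxy xa aj.
  - by rewrite ya f3a f3D//; apply: lt_trans uz; rewrite -fa; apply: flt; rewrite // -ya.
  - by rewrite !f3D//; exact: flt.
apply: (local_iso_cancel f3_iso) => [|x /= xs]; last first.
  by rewrite /exch; case: ifP => // _; case: ifP.
apply: (@eq_local_iso _ _ _ _ (exch u v \o f1)) => [x /= xs|].
  have [->|xa] := pselect (x = a).
    by rewrite f1D// fa !exchL f3D ?fb//; exact/nesym.
  have [->|xb] := pselect (x = b).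
    by rewrite f1b exchR f3a exchD//; exact/nesym.
  rewrite f1D// (exchD xa xb) f3D// exchD// => fx.
    by apply: xa; apply: fI; rewrite ?fa.
  by apply: xb; apply: fI; rewrite ?fb.
apply: local_iso_comp f1_iso uv _ => x xs; split=> /=.
  by have [->|xb] := pselect (x = b); rewrite ?f1b ?f1D//; have [] := fD x xs.
have [->|xb] := pselect (x = b); first by rewrite f1b.
rewrite f1D// => fx; by apply: xb; apply: fI; rewrite ?fb.
Qed.

End Chains.

(** * Ordered classes are dense *)

Section Dense.
Context {I : Type} {ar : I -> nat} {R : structure ar}.

Lemma prehomogeneous_extend : prehomogeneous R -> forall s : seq R,
  exists2 s' : seq R, {subset s <= s'} & forall f, local_iso [set` s'] f ->
    exists g, [/\ local_iso setT g, g @` setT = setT & forall x, x \in s -> g x = f x].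
Proof.
move=> prehom s; have [F' [+ sF' ext]] := prehom _ (finite_seq s).
move=> /finite_seqP[s' s'E]; exists s' => [x xs|f fs'].
  by have := sF' x xs; rewrite s'E.
have fs : local_iso [set` s] f by apply: local_iso_sub fs'; rewrite -s'E.
have [h hI hE] := local_iso_isomorphism fs.
have fF' : local_iso F' f by rewrite s'E.
have [h' h'I h'E] := local_iso_isomorphism fF'.
have [|g [gI gE]] := ext _ h hI.
  by exists (f @` F'), h'; split=> // x x' xx'; rewrite h'E hE xx'.
have [gT gS] := isomorphism_local_iso gI; exists g; split=> // x xs.
have xs' : x \in [set` s] by apply/mem_set.
by have := gE (exist (fun z => z \in [set` s]) x xs'); rewrite hE.
Qed.

Variables (c : R -> nat) (lt : rel R).
Hypothesis mc : multichain c lt.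
Hypothesis prehom : prehomogeneous R.

Lemma infinite_fiber_far (j n : nat) : infinite_set [set z | c z = j] ->
  exists u z v, [/\ c u = j, c z = j & c v = j] /\ [/\ lt u z & lt z v] /\
    room n [set w | c w = j /\ lt w u] /\ room n [set w | c w = j /\ lt v w].
Proof.
move=> /(infinite_room (n + (n + 3)))[w0 [uw0 sw0 w0j]].
have [w pw sw] := sorted_listing mc uw0.
have wsize : size w = n + (n + 3) by rewrite (perm_size pw).
have wj x : x \in w -> c x = j by rewrite (perm_mem pw) => /w0j.
have uw : uniq w by rewrite (perm_uniq pw).
have lt_trans := mc_trans mc.
case dE : (drop n w) => [|u [|z [|v r]]]; have := congr1 size dE;
  rewrite size_drop wsize addKn ?addn3 //= => -[rn].
have wE : w = take n w ++ [:: u, z, v & r] by rewrite -dE cat_take_drop.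
move: uw sw; rewrite wE cat_uniq sorted_pairwise// pairwise_cat.
move=> /and3P[ut _ /and4P[_ _ _ ur]] /and3P[/allrelP tl _] /=.
move=> /and4P[/and3P[uz uv _] /andP[zv _] vr _].
have inw x : x \in [:: u, z, v & r] -> x \in w by rewrite wE mem_cat orbC => ->.
exists u, z, v; split; first by split; apply/wj/inw; rewrite !inE eqxx ?orbT.
split=> //; split.
  exists (take n w); split=> //; first by rewrite size_takel// wsize leq_addr.
  by move=> x /= xt; split; [apply/wj/(mem_take xt)|apply: tl => //; rewrite mem_head].
exists r; split=> // x xr; split; last by move/allP: vr; apply.
by apply/wj/inw; rewrite !inE xr !orbT.
Qed.

(** If a < b were consecutive, b would replace a.  Inside the infinite class a
    finite set containing a and b can be spread so that their images u, v are
    no longer consecutive and have plenty of room around them; prehomogeneity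
    extends this move to an automorphism, so v replaces u and [exch_fiber] makes
    the class interchangeable. *)
Lemma fiber_dense (j : nat) (a0 b0 : R) : infinite_set [set z | c z = j] ->
  c a0 = j -> c b0 = j -> ~ interchangeable a0 b0 ->
  forall a b, c a = j -> c b = j -> lt a b ->
  exists z, [/\ c z = j, lt a z & lt z b].
Proof.
move=> infj a0j b0j nab0 a b aj bj ab; apply: contrapT => nz; apply: nab0.
have ltxx := mc_irr mc; have lt_trans := mc_trans mc.
have ab_repl : replaceable setT a b.
  apply: (mc_iso mc) => [x [_ xb]|x y [_ xb] [_ yb] cxy xy].
    by have [->|xa] := pselect (x = a); rewrite ?exchL ?exchD ?aj.
  have [xa|xa] := pselect (x = a); have [ya|ya] := pselect (y = a).
  - by move: xy; rewrite xa ya ltxx.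
  - rewrite xa exchL exchD//; rewrite xa in xy cxy.
    have := mc_total mc b y => /or3P[/eqP/esym//|//|yb'].
    by case: nz; exists y; rewrite -cxy.
  - by rewrite ya exchL exchD//; apply: lt_trans ab; rewrite -ya.
  - by rewrite !exchD.
have [F' sF' ext] := prehomogeneous_extend prehom [:: a; b].
have aF : a \in F' by apply: sF'; rewrite mem_head.
have bF : b \in F' by apply: sF'; rewrite !inE eqxx orbT.
apply: (exch_fiber mc (j := j) (D := setT) (eps := id)) => // n.
have [u [z [v [[uj zj vj] [[uz zv] [lo hi]]]]]] := infinite_fiber_far (n + size F') infj.
have roomE m (P : set R) : room m [set w | c w = j /\ P w] ->
    room m [set w | [/\ [set: R] w, c w = j & P w]].
  by apply: room_sub => // w [].
exists u, z, v; split=> //; split=> //.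
have lo' := room_sub (leq_addr _ _) (fun _ => id) lo.
have hi' := room_sub (leq_addr _ _) (fun _ => id) hi.
have lo2 := room_sub (leq_addl _ _) (fun _ => id) lo.
have hi2 := room_sub (leq_addl _ _) (fun _ => id) hi.
split; last by split; [exact: (roomE _ (fun w => lt w u))|exact: (roomE _ (lt v))].
have [|||||f [fa fb fc flt _]] := @fiber_fit _ _ _ _ _ mc j setT id F' a b u v _ _
  aj bj uj vj Logic.I Logic.I aF bF.
- by [].
- by [].
- right; split=> //; first exact: lt_trans zv.
  by move=> x _ xj ax xb; apply: nz; exists x.
- exact: (roomE _ (fun w => lt w u)).
- exact: (roomE _ (lt v)).
have [|g [gR gS gE]] := ext f.
  by apply: (mc_iso mc) => // x /fc[].
split=> //; rewrite -fa -fb -!gE ?inE ?eqxx ?orbT//.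
by have := replaceable_map gR (x := a) (y := b) Logic.I Logic.I ab_repl; rewrite gS.
Qed.

End Dense.

(** * Countable chains embed into dense chains *)

Lemma seq_max (S : eqType) (lt : rel S) (x0 : S) (s : seq S) : transitive lt ->
  (forall x y, [|| x == y, lt x y | lt y x]) -> x0 \in s ->
  exists2 m, m \in s & forall x, x \in s -> x = m \/ lt x m.
Proof.
move=> lt_trans lt_total.
elim: s x0 => [//|y s IH] _ _; case: s IH => [_|z s IH].
  by exists y; rewrite ?mem_head// => x; rewrite inE => /eqP; left.
have [m ms mmax] := IH z (mem_head _ _).
have := lt_total y m => /or3P[/eqP ym|ym|my].
- exists m => [|x]; first by rewrite in_cons ms orbT.
  by rewrite inE => /predU1P[->|/mmax]; [left|].
- exists m => [|x]; first by rewrite in_cons ms orbT.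
  by rewrite inE => /predU1P[->|/mmax]; [right|].
exists y; rewrite ?mem_head// => x; rewrite inE => /predU1P[->|/mmax[->|xm]]; first by left.
  by right.
by right; exact: lt_trans my.
Qed.

Section DenseUniversal.
Variables (S : eqType) (lt : rel S) (V : set S).
Hypothesis lt_trans : transitive lt.
Hypothesis lt_total : forall x y, [|| x == y, lt x y | lt y x].
Hypothesis V_ne : V !=set0.
Hypothesis V_lower : forall x, V x -> exists2 y, V y & lt y x.
Hypothesis V_upper : forall x, V x -> exists2 y, V y & lt x y.
Hypothesis V_dense : forall x y, V x -> V y -> lt x y ->
  exists z, [/\ V z, lt x z & lt z y].

Lemma finite_cut (lo hi : seq S) : [set` lo] `<=` V -> [set` hi] `<=` V ->
  (forall x y, x \in lo -> y \in hi -> lt x y) ->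
  exists v, [/\ V v, forall x, x \in lo -> lt x v & forall y, y \in hi -> lt v y].
Proof.
move=> loV hiV lohi.
have total' x y : [|| x == y, lt y x | lt x y].
  by have := lt_total x y => /or3P[]->; rewrite ?orbT.
have trans' : transitive (fun x y => lt y x) by move=> x y z yx xz; exact: lt_trans yx.
have below m v (s : seq S) : (forall x, x \in s -> x = m \/ lt x m) -> lt m v ->
    forall x, x \in s -> lt x v.
  by move=> H mv x /H[->//|xm]; exact: lt_trans mv.
have above m v (s : seq S) : (forall x, x \in s -> x = m \/ lt m x) -> lt v m ->
    forall x, x \in s -> lt v x.
  by move=> H mv x /H[->//|xm]; exact: lt_trans xm.
case: lo loV lohi => [|x0 lo] loV lohi; case: hi hiV lohi => [|y0 hi] hiV lohi.
- by have [v Vv] := V_ne; exists v.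
- have [M My Mmin] := seq_max trans' total' (mem_head y0 hi).
  have [v Vv vM] := V_lower (hiV _ My); exists v; split=> //; exact: above vM.
- have [m mx mmax] := seq_max lt_trans lt_total (mem_head x0 lo).
  have [v Vv vM] := V_upper (loV _ mx); exists v; split=> //; exact: below vM.
have [M My Mmin] := seq_max trans' total' (mem_head y0 hi).
have [m mx mmax] := seq_max lt_trans lt_total (mem_head x0 lo).
have [v [Vv mv vM]] := V_dense (loV _ mx) (hiV _ My) (lohi _ _ mx My).
by exists v; split=> //; [exact: below mv|exact: above vM].
Qed.

(** Cantor's construction: the points of T are placed one after the other, each
    in the cut that the finitely many earlier ones determine. *)
Lemma dense_universal (T : choiceType) (ltT : rel T) : countable [set: T] ->
  irreflexive ltT -> transitive ltT ->
  exists2 h : T -> S, (forall t, V (h t)) & (forall s t, ltT s t -> lt (h s) (h t)).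
Proof.
move=> /countable_injP[code codeI'] ltT_irr ltT_trans.
have codeI x y : code x = code y -> x = y by move=> /codeI'; apply; rewrite inE.
pose P n (h : T -> S) := (forall t, code t < n -> V (h t)) /\
  (forall s t, code s < n -> code t < n -> ltT s t -> lt (h s) (h t)).
have /choice[F FP] : forall nh : nat * (T -> S), exists h', P nh.1 nh.2 ->
    P nh.1.+1 h' /\ forall t, code t < nh.1 -> h' t = nh.2 t.
  case=> n h /=; have [[hV hlt]|] := pselect (P n h); last by exists h.
  have [[t0 t0n]|nt] := pselect (exists t0, code t0 = n); last first.
    have lt_n t : code t < n.+1 -> code t < n.
      by rewrite ltnS leq_eqVlt => /predU1P[tn|//]; case: nt; exists t.
    by exists h => _; split=> //; split=> [t /lt_n/hV//|s t /lt_n sn /lt_n]; exact: hlt.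
  have /finite_seqP[e eE] : finite_set [set t | code t < n].
    by apply: (@finite_preimage _ _ `I_n) => // x y _ _; exact: codeI.
  have eP t : (t \in e) = (code t < n).
    apply/idP/idP => te; first by have : [set` e] t by []; rewrite -eE.
    by have : [set t | code t < n] t by []; rewrite eE.
  have [|||v [Vv lov hiv]] :=
    @finite_cut [seq h s | s <- e & ltT s t0] [seq h s | s <- e & ltT t0 s].
  - by move=> _ /mapP[s + ->]; rewrite mem_filter eP => /andP[_ /hV].
  - by move=> _ /mapP[s + ->]; rewrite mem_filter eP => /andP[_ /hV].
  - move=> _ _ /mapP[s + ->] /mapP[t + ->]; rewrite !mem_filter !eP.
    by move=> /andP[st0 sn] /andP[t0t tn]; apply: hlt => //; exact: ltT_trans t0t.
  pose h' t := if code t == n then v else h t.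
  have h'n t : code t < n -> h' t = h t by rewrite /h'; case: ltngtP.
  have h't0 : h' t0 = v by rewrite /h' t0n eqxx.
  have cases t : code t < n.+1 -> t = t0 \/ code t < n.
    by rewrite ltnS leq_eqVlt -t0n => /predU1P[/codeI|]; [left|right].
  exists h' => _; split=> //; split=> [t /cases[->|tn]|s t /cases[->|sn] /cases[->|tn] st].
  - by rewrite h't0.
  - by rewrite h'n//; exact: hV.
  - by rewrite ltT_irr in st.
  - by rewrite h't0 h'n//; apply/hiv/map_f; rewrite mem_filter st eP.
  - by rewrite h't0 h'n//; apply/lov/map_f; rewrite mem_filter st eP.
  - by rewrite !h'n//; exact: hlt.
have [v0 Vv0] := V_ne.
pose H := fix H n := if n is n'.+1 then F (n', H n') else fun=> v0.
have HP n : P n (H n).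
  by elim: n => [|n IH]; [split|have [] := FP (n, H n) IH].
have HS n t : code t < n -> H n t = H (code t).+1 t.
  elim: n => [//|n IH]; rewrite ltnS leq_eqVlt => /predU1P[->//|tn].
  by rewrite -IH//; have [_ E] := FP (n, H n) (HP n); exact: E.
exists (fun t => H (code t).+1 t) => [t|s t st]; first by apply: (HP _).1.
set m := maxn (code s).+1 (code t).+1.
rewrite -(HS m s) ?leq_maxl// -(HS m t) ?leq_maxr//.
by apply: (HP m).2; rewrite ?leq_maxl ?leq_maxr.
Qed.

End DenseUniversal.

(** * Inflating the points of the ordered classes *)

Lemma room_unbounded (T : eqType) (lt : rel T) (n : nat) (W : set T) :
  irreflexive lt -> transitive lt -> W !=set0 ->
  (forall x, W x -> exists2 y, W y & lt y x) -> room n W.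
Proof.
move=> ltxx lt_trans [x0 Wx0] low.
suff [s [us sn sW _]] : exists s : seq T, [/\ uniq s, size s = n, [set` s] `<=` W &
    exists2 m, W m & forall x, x \in s -> lt m x] by exists s.
elim: n => [|n [s [us sn sW [m Wm ms]]]].
  by exists [::]; split=> //; exists x0.
have [m' Wm' m'm] := low m Wm.
exists (m :: s); split; rewrite /= ?sn ?us ?andbT//.
- by apply/negP => /ms; rewrite ltxx.
- by move=> x; rewrite /= inE => /predU1P[->//|/sW].
- exists m' => // x; rewrite inE => /predU1P[->//|/ms]; exact: lt_trans.
Qed.

Section OrderedFibers.
Context {I : Type} {ar : I -> nat} {R : structure ar}.
Variables (c : R -> nat) (lt : rel R).
Hypothesis mc : multichain c lt.
Hypothesis prehom : prehomogeneous R.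
Hypothesis countable_R : countable [set: R].

Let ltxx x : lt x x = false. Proof. exact: (mc_irr mc). Qed.
Let lt_trans : transitive lt. Proof. exact: (mc_trans mc). Qed.
Let lt_asym x y : lt x y -> lt y x -> False. Proof. exact: (multichain_asym mc). Qed.

Definition ordered (j : nat) : Prop := infinite_set [set z | c z = j] /\
  exists a b, [/\ c a = j, c b = j & ~ interchangeable a b].

Lemma ordered_dense j a b : ordered j -> c a = j -> c b = j -> lt a b ->
  exists z, [/\ c z = j, lt a z & lt z b].
Proof.
by move=> [infj [a0 [b0 [a0j b0j nab]]]]; apply: (fiber_dense mc prehom infj a0j b0j nab).
Qed.

(** End points of an ordered class are set aside, so that the interior points
    form a dense chain without end points. *)
Definition interior (x : R) : Prop := exists y z,
  [/\ c y = c x, c z = c x, lt y x & lt x z].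

Let interiors j := [set x | c x = j /\ interior x].

Lemma interior_dense j x y : ordered j -> interiors j x -> interiors j y -> lt x y ->
  exists z, [/\ interiors j z, lt x z & lt z y].
Proof.
move=> oj [xj _] [yj _] /(ordered_dense oj xj yj)[z [zj xz zy]]; exists z; split=> //.
by split=> //; exists x, y; rewrite xj yj zj.
Qed.

Lemma interior_lower j x : ordered j -> interiors j x ->
  exists2 y, interiors j y & lt y x.
Proof.
move=> oj [xj [u [v [uj vj ux xv]]]]; rewrite xj in uj vj.
have [z [zj uz zx]] := ordered_dense oj uj xj ux; exists z => //; split=> //.
by exists u, x; rewrite xj uj zj.
Qed.

Lemma interior_upper j x : ordered j -> interiors j x ->
  exists2 y, interiors j y & lt x y.
Proof.
move=> oj [xj [u [v [uj vj ux xv]]]]; rewrite xj in uj vj.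
have [z [zj xz zv]] := ordered_dense oj xj vj xv; exists z => //; split=> //.
by exists x, v; rewrite xj vj zj.
Qed.

Lemma interior_nonempty j : ordered j -> interiors j !=set0.
Proof.
move=> [infj _]; have [u [z [v [[uj zj vj] [[uz zv] _]]]]] := infinite_fiber_far mc 0 infj.
by exists z; split=> //; exists u, v; rewrite uj vj zj.
Qed.

Lemma interior_universal j (T : choiceType) (ltT : rel T) : ordered j ->
  countable [set: T] -> irreflexive ltT -> transitive ltT ->
  exists2 h : T -> R, (forall t, interiors j (h t)) & (forall s t, ltT s t -> lt (h s) (h t)).
Proof.
move=> oj; apply: (dense_universal lt_trans (mc_total mc)).
- exact: interior_nonempty.
- by move=> x; exact: interior_lower.
- by move=> x; exact: interior_upper.
- by move=> x y; exact: interior_dense.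
Qed.

Definition lex (p q : R * nat) : bool := lt p.1 q.1 || (p.1 == q.1) && (p.2 < q.2).

(** Room for a chain of any length at each point: i v k is the k-th point of the
    chain that takes the place of v. *)
Lemma ex_blowup : exists i : R -> nat -> R, forall v w k l, ordered (c v) -> c w = c v ->
  [/\ c (i v k) = c v, interior (i v k) & lex (v, k) (w, l) -> lt (i v k) (i w l)].
Proof.
have lex_irr : irreflexive lex by move=> p; rewrite /lex ltxx ltnn andbF.
have lex_trans : transitive lex.
  move=> [y m] [x n] [z p]; rewrite /lex /=.
  move=> /orP[xy|/andP[/eqP-> nm]] /orP[yz|/andP[/eqP<- mp]].
  - by rewrite (lt_trans xy yz).
  - by rewrite xy.
  - by rewrite yz.
  - by rewrite eqxx (ltn_trans nm mp) orbT.
have cRn : countable [set: R * nat].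
  by rewrite -setXTT; apply: countableX => //; exact: countableP.
have /choice[h hP] : forall j, exists h : R * nat -> R, ordered j ->
    (forall t, interiors j (h t)) /\ (forall s t, lex s t -> lt (h s) (h t)).
  move=> j; have [oj|] := pselect (ordered j); last by exists fst.
  by have [h h1 h2] := interior_universal oj cRn lex_irr lex_trans; exists h.
exists (fun v k => h (c v) (v, k)) => v w k l ov cwv.
have [h1 h2] := hP _ ov; have [h1c h1i] := h1 (v, k); split=> //.
by rewrite cwv; exact: h2.
Qed.

End OrderedFibers.

Section Component.
Context {I : Type} {ar : I -> nat} {R : structure ar}.
Implicit Types D : set R.

Definition replaceable_closed D (C : set R) : Prop :=
  forall u w, C u -> D u -> D w -> replaceable D u w -> C w.

(** The connected component of x in the graph of replacements, as the least set
    containing x and closed under replacement. *)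
Definition component D (x : R) : set R :=
  [set y | forall C, C x -> replaceable_closed D C -> C y].

Lemma component_sub D x : D x -> component D x `<=` D.
Proof. by move=> Dx y; apply=> // u w. Qed.

Lemma component_map D (f : R -> R) x y : local_iso D f -> D x ->
  component D x y -> component (f @` D) (f x) (f y).
Proof.
move=> fR Dx xy C Cfx Cclosed; apply: (xy (fun u => C (f u))) => // u w Cu Du Dw uw.
by apply: (Cclosed (f u) (f w)) => //; exact: replaceable_map.
Qed.

Lemma component_image D (f : R -> R) x : local_iso D f -> D x ->
  component (f @` D) (f x) = f @` component D x.
Proof.
move=> fR Dx; apply/seteqP; split=> [y xy|_ [y xy <-]]; last exact: component_map.
have [g [gR gK fK]] := local_iso_inverse fR.
have Dfx : (f @` D) (f x) by exists x.
have gfD : g @` (f @` D) = D.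
  apply/seteqP; split=> [_ [_ [z Dz <-] <-]|z Dz]; first by rewrite gK.
  by exists (f z); [exists z|exact: gK].
exists (g y); last by have [] := fK y (component_sub Dfx xy).
by have := component_map gR Dfx xy; rewrite gfD gK.
Qed.

(** Asking for infinitely many points makes the invariant insensitive to the
    finite label classes, whose components are not controlled. *)
Definition many_components D (m : nat) : Prop :=
  infinite_set [set x | D x /\ component D x #= `I_m].

Lemma many_components_image D (f : R -> R) m : local_iso D f ->
  many_components D m -> many_components (f @` D) m.
Proof.
move=> fR; rewrite /many_components.
set S := [set x | D x /\ _].
have fS : f @` S #= S.
  by apply: inj_card_eq => x y /set_mem[Dx _] /set_mem[Dy _]; exact: fR.1.
rewrite -(eq_finite_set fS); apply: sub_infinite_set => _ [x [Dx cx] <-].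
split; first by exists x.
rewrite component_image// (card_eq_trans _ cx)// inj_card_eq// => u v.
by move=> /set_mem/(component_sub Dx) Du /set_mem/(component_sub Dx) Dv; exact: fR.1.
Qed.

End Component.

Section Blowup.
Context {I : Type} {ar : I -> nat} {R : structure ar}.
Variables (c : R -> nat) (lt : rel R).
Hypothesis mc : multichain c lt.
Hypothesis prehom : prehomogeneous R.
Variable i : R -> nat -> R.
Local Notation ordered := (ordered c).
Local Notation interior := (interior c lt).
Hypothesis iP : forall v w k l, ordered (c v) -> c w = c v ->
  [/\ c (i v k) = c v, interior (i v k) & lex lt (v, k) (w, l) -> lt (i v k) (i w l)].
Variable nu : R -> nat.
Hypothesis nu_gt0 : forall v, (0 < nu v) <-> interior v.

Let ltxx x : lt x x = false. Proof. exact: (mc_irr mc). Qed.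
Let lt_trans : transitive lt. Proof. exact: (mc_trans mc). Qed.
Let lt_total x y : x <> y -> lt x y \/ lt y x. Proof. exact: (multichain_connex mc). Qed.
Let lt_asym x y : lt x y -> lt y x -> False. Proof. exact: (multichain_asym mc). Qed.

Let ci v k : ordered (c v) -> c (i v k) = c v.
Proof. by move=> ov; have [] := @iP v v k 0 ov erefl. Qed.
Let ii v k : ordered (c v) -> interior (i v k).
Proof. by move=> ov; have [] := @iP v v k 0 ov erefl. Qed.
Let ilt v k w l : ordered (c v) -> c w = c v -> lex lt (v, k) (w, l) -> lt (i v k) (i w l).
Proof. by move=> ov cw; have [] := @iP v w k l ov cw. Qed.

(** A point v of an ordered class is inflated to nu v points, so the multiplicity
    zero deletes it; by nu_gt0 this is the fate of the points that are not
    interior. *)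
Definition blowup : set R := [set x | ordered (c x) ->
  exists v k, [/\ c v = c x, k < nu v & x = i v k]].
Local Notation D := blowup.

Lemma blowup_i v k : ordered (c v) -> k < nu v -> D (i v k).
Proof. by move=> ov kv _; exists v, k; rewrite ci. Qed.

Lemma i_inj v k w l : ordered (c v) -> c w = c v -> i v k = i w l -> v = w /\ k = l.
Proof.
move=> ov cw; have ow : ordered (c w) by rewrite cw.
have [->|vw] := pselect (v = w).
  move=> E; split=> //; have [kl|kl|//] := ltngtP k l.
    have := @ilt w k w l ow erefl; rewrite /lex /= eqxx kl orbT E ltxx.
    by move=> /(_ isT).
  have := @ilt w l w k ow erefl; rewrite /lex /= eqxx kl orbT E ltxx.
  by move=> /(_ isT).
have [vw'|wv] := lt_total vw.
  by have := @ilt v k w l ov cw; rewrite /lex /= vw' => /(_ isT) + E; rewrite E ltxx.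
by have := @ilt w l v k ow (esym cw); rewrite /lex /= wv => /(_ isT) + E; rewrite E ltxx.
Qed.

Lemma blowup_lower j x : ordered j -> D x -> c x = j ->
  exists2 y, D y /\ c y = j & lt y x.
Proof.
move=> oj Dx xj; have ox : ordered (c x) by rewrite xj.
have [v [k [cv kv ->]]] := Dx ox; rewrite -cv in ox.
have iv : interior v by apply/nu_gt0; exact: leq_trans kv.
have [w [cw iw] wv] := interior_lower mc prehom ox (conj erefl iv).
have ow : ordered (c w) by rewrite cw.
exists (i w 0); last by apply: ilt; rewrite // /lex /= wv.
by split; [apply: blowup_i => //; apply/nu_gt0|rewrite ci// cw cv].
Qed.

Lemma blowup_upper j x : ordered j -> D x -> c x = j ->
  exists2 y, D y /\ c y = j & lt x y.
Proof.
move=> oj Dx xj; have ox : ordered (c x) by rewrite xj.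
have [v [k [cv kv ->]]] := Dx ox; rewrite -cv in ox.
have iv : interior v by apply/nu_gt0; exact: leq_trans kv.
have [w [cw iw] vw] := interior_upper mc prehom ox (conj erefl iv).
have ow : ordered (c w) by rewrite cw.
exists (i w 0); last by apply: ilt; rewrite // /lex /= vw.
by split; [apply: blowup_i => //; apply/nu_gt0|rewrite ci// cw cv].
Qed.

Lemma blowup_room_lower n j x : ordered j -> D x -> c x = j ->
  room n [set z | [/\ D z, c z = j & lt z x]].
Proof.
move=> oj Dx xj; apply: (room_unbounded _ ltxx lt_trans).
  by have [y [Dy yj] yx] := blowup_lower oj Dx xj; exists y.
move=> y [Dy yj yx]; have [z [Dz zj] zy] := blowup_lower oj Dy yj.
by exists z => //; split=> //; exact: lt_trans yx.
Qed.

Lemma blowup_room_upper n j x : ordered j -> D x -> c x = j ->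
  room n [set z | [/\ D z, c z = j & lt x z]].
Proof.
move=> oj Dx xj; apply: (@room_unbounded _ (fun y z => lt z y)) => //.
- by move=> y z t yz ty; exact: lt_trans yz.
- by have [y [Dy yj] yx] := blowup_upper oj Dx xj; exists y.
move=> y [Dy yj xy]; have [z [Dz zj] yz] := blowup_upper oj Dy yj.
by exists z => //; split=> //; exact: lt_trans yz.
Qed.

(** A map of R into the blowup: i x 0 is interior, hence has a positive
    multiplicity, and its chain has a first point. *)
Definition squeeze (x : R) : R := if pselect (ordered (c x)) then i (i x 0) 0 else x.

Lemma c_squeeze x : c (squeeze x) = c x.
Proof.
by rewrite /squeeze; case: pselect => // ox; rewrite !ci// ci.
Qed.

Lemma squeeze_blowup x : D (squeeze x).
Proof.
rewrite /squeeze; case: pselect => [ox|nox]; last by move=> ox.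
by apply: blowup_i; [rewrite ci|apply/nu_gt0/ii].
Qed.

Lemma squeeze_lt x y : c x = c y -> lt x y -> lt (squeeze x) (squeeze y).
Proof.
move=> cxy xy; rewrite /squeeze -cxy; case: pselect => // ox.
have oy : ordered (c y) by rewrite -cxy.
apply: ilt; rewrite ?ci// /lex /=; rewrite ilt// /lex/= ?xy //.
Qed.

Lemma replaceable_between j x y z : ordered j -> D x -> D y -> D z ->
  c x = j -> c y = j -> c z = j -> lt x z -> lt z y -> ~ replaceable D x y.
Proof.
move=> oj Dx Dy Dz xj yj zj xz zy xy; have [_ [a [b [aj bj]]]] := oj; apply.
apply: (exch_fiber mc squeeze_blowup c_squeeze squeeze_lt _ aj bj) => n.
exists x, z, y; split=> //; split=> //; split=> //; split.
  exact: blowup_room_lower.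
exact: blowup_room_upper.
Qed.

(** When y has another label, only the position of x in its class matters, and
    it has infinite room on both sides: fix the other classes and move x' to
    x. *)
Lemma replaceable_transport j x x' y : ordered j -> D x -> D x' -> D y ->
  c x = j -> c x' = j -> c y <> j -> replaceable D x y -> replaceable D x' y.
Proof.
move=> oj Dx Dx' Dy xj x'j yj xy; apply: local_iso_finitary => s sD.
pose s' := [:: x', y & s].
have [|||||||f [fx' _ fcD flt feps]] := @fiber_fit _ _ _ _ _ mc j D id s' x' x' x x _ _
  x'j x'j xj xj Dx Dx.
- by [].
- by [].
- by rewrite mem_head.
- by rewrite mem_head.
- by left.
- exact: blowup_room_lower.
- exact: blowup_room_upper.
have x's' : x' \in s' by rewrite mem_head.
have fI u w : u \in s' -> w \in s' -> f u = f w -> u = w.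
  move=> us ws fuw; have cuw : c u = c w.
    by have [<- _] := fcD u us; have [<- _] := fcD w ws; rewrite fuw.
  apply: contrapT => /lt_total[/(flt _ _ us ws cuw)|]; first by rewrite fuw ltxx.
  by move=> /(flt _ _ ws us (esym cuw)); rewrite fuw ltxx.
have fR : local_iso [set` s'] f by apply: (mc_iso mc) => // u /fcD[].
have ss' u : u \in s -> u \in s' by rewrite !inE => ->; rewrite !orbT.
have fy u : u \in s' -> f u = y -> u = y.
  move=> us fu; apply: contrapT => uy.
  have [cu|cu] := pselect (c u = j); last by apply: uy; rewrite -fu feps.
  by apply: yj; rewrite -fu; have [->] := fcD u us.
have fD u : u \in s -> D (f u).
  move=> us; have [Du _] := sD _ us; have [cu fu] := fcD u (ss' _ us).
  by have [/fu//|uj] := pselect (c u = j); rewrite feps.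
apply: (local_iso_cancel fR) => [|u /= us]; last first.
  rewrite /exch; case: ifP => _; first by rewrite !inE eqxx orbT.
  by case: ifP => _; [rewrite mem_head|exact: ss'].
apply: (@eq_local_iso _ _ _ _ (exch x y \o f)) => [u us /=|].
  have [_ /= uy] := sD _ us.
  have [->|ux'] := pselect (u = x'); first by rewrite fx' !exchL feps.
  rewrite (exchD ux' uy) exchD//.
    by rewrite -fx' => /(fI _ _ (ss' _ us) x's').
  by move=> /(fy _ (ss' _ us)).
apply: local_iso_comp (local_iso_sub _ fR) xy _ => [u /ss'//|u us].
have [_ /= uy] := sD _ us.
by split; [exact: fD|move=> /(fy _ (ss' _ us))].
Qed.

(** Passing through y gives a replacement of x by x' in any set that avoids y.
    If y is present, it is first replaced by a fresh point x2 of the class, and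
    put back afterwards. *)
Lemma replaceable_hub j x x' y : ordered j -> D x -> D x' -> D y ->
  c x = j -> c x' = j -> c y <> j -> replaceable D x y -> replaceable D x x'.
Proof.
move=> oj Dx Dx' Dy xj x'j yj xy.
have hub z : D z -> c z = j -> replaceable D z y.
  by move=> Dz zj; exact: (replaceable_transport oj Dx Dz Dy xj zj yj xy).
have ny z : c z = j -> z <> y by move=> zj zy; apply: yj; rewrite -zy.
have off (s : seq R) : [set` s] `<=` D `\ x' -> y \notin s -> local_iso [set` s] (exch x x').
  move=> sD ys; have sy u : u \in s -> u <> y by move=> us uy; rewrite -uy us in ys.
  apply: (@eq_local_iso _ _ _ _ (exch y x' \o exch x y)) => [u us /=|].
    have [_ /= ux'] := sD _ us; have uy := sy _ us.
    have [->|ux] := pselect (u = x); first by rewrite !exchL.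
    by rewrite !exchD.
  apply: local_iso_comp (local_iso_sub _ xy) (replaceable_sym Dx' Dy (hub _ Dx' x'j)) _.
    by move=> u us; have [Du _] := sD _ us; split=> //; exact: sy.
  move=> u us; have [Du ux'] := sD _ us.
  have [->|ux] := pselect (u = x); first by rewrite exchL; split=> // /esym; exact: ny.
  by rewrite exchD//; exact: sy.
have [<-|xx'] := pselect (x = x').
  by rewrite /replaceable exchxx; exact: local_iso_id.
apply: local_iso_finitary => s sD.
have [ys|ys] := boolP (y \in s); last exact: off.
have [x2 [x2s x2x x2x' Dx2 x2j]] : exists x2, [/\ x2 \notin s, x2 <> x, x2 <> x', D x2 & c x2 = j].
  have [r [ur sr rD]] := blowup_room_lower (size [:: x, x' & s]).+1 oj Dx xj.
  have /allPn[x2 x2r] : ~~ all (mem [:: x, x' & s]) r.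
    by apply/negP => /allP/(uniq_leq_size ur); rewrite sr ltnn.
  move=> /negP x2n; have [? ? _] := rD _ x2r; exists x2; split=> //.
  - by apply/negP => x2s; apply: x2n; rewrite /= !in_cons x2s !orbT.
  - by move=> E; apply: x2n; rewrite /= E mem_head.
  - by move=> E; apply: x2n; rewrite /= E !in_cons eqxx orbT.
have x2y := ny _ x2j.
pose s1 := map (exch y x2) s; pose s2 := map (exch x x') s1.
have s1D : [set` s1] `<=` D `\ x'.
  move=> _ /mapP[u us ->]; have [Du ux'] := sD _ us.
  have [->|uy] := pselect (u = y); first by rewrite exchL.
  have [ux2|ux2] := pselect (u = x2); first by rewrite -ux2 us in x2s.
  by rewrite exchD.
have ys1 : y \notin s1.
  apply/negP => /mapP[u us] /(congr1 (exch y x2)); rewrite exchK exchL => ux2.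
  by rewrite ux2 us in x2s.
have l1 : local_iso [set` s] (exch y x2).
  apply: local_iso_sub (replaceable_sym Dx2 Dy (hub _ Dx2 x2j)) => u us.
  by have [Du _] := sD _ us; split=> // ux2; rewrite -ux2 us in x2s.
have l2 : local_iso [set` s1] (exch x x') by exact: off.
have l3 : local_iso [set` s2] (exch x2 y).
  apply: local_iso_sub (hub _ Dx2 x2j) => _ /mapP[u us1 ->].
  have [Du ux'] := s1D _ us1.
  have [->|ux] := pselect (u = x); first by rewrite exchL; split=> //; exact: ny.
  by rewrite exchD//; split=> // uy; rewrite -uy us1 in ys1.
apply: (@eq_local_iso _ _ _ _ (exch x2 y \o (exch x x' \o exch y x2))) => [u us /=|].
  have [Du ux'] := sD _ us.
  have [ux2|ux2] := pselect (u = x2); first by rewrite -ux2 us in x2s.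
  have xy' := ny _ xj; have x'y := ny _ x'j.
  have [->|uy] := pselect (u = y).
    by rewrite exchL (@exchD _ x x' x2)// exchL exchD//; exact/nesym.
  rewrite (@exchD _ y x2 u)//; have [->|ux] := pselect (u = x).
    by rewrite exchL exchD//; exact/nesym.
  by rewrite (@exchD _ x x' u)// exchD.
apply: local_iso_comp l1 (local_iso_comp l2 l3 _) _ => u us; exact: map_f.
Qed.

(** Otherwise [replaceable_hub] would provide a replacement between points of
    the class that are far apart. *)
Lemma replaceable_same_label x y : ordered (c x) -> D x -> D y ->
  replaceable D x y -> c y = c x.
Proof.
move=> ox Dx Dy xy; apply: contrapT => cyx.
have [z [Dz zj] xz] := blowup_upper ox Dx erefl.
have [t [Dt tj] zt] := blowup_upper ox Dz zj.
apply: (@replaceable_between (c x) x t z) => //.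
exact: (@replaceable_hub (c x) x t y).
Qed.

(** Between points of distinct chains there is a third chain, by density. *)
Lemma replaceable_i v k y : ordered (c v) -> k < nu v -> D y ->
  replaceable D (i v k) y -> exists2 l, l < nu v & y = i v l.
Proof.
move=> ov kv Dy xy; have Dx := blowup_i ov kv.
have cy : c y = c v by rewrite -(ci k ov); apply: replaceable_same_label; rewrite ?ci.
have oy : ordered (c y) by rewrite cy.
have [w [l [cw lw yE]]] := Dy oy; rewrite cy in cw.
have [vw|vw] := pselect (v = w); first by exists l; rewrite vw.
have ow : ordered (c w) by rewrite cw.
have iv : interior v by apply/nu_gt0; exact: leq_trans kv.
have iw : interior w by apply/nu_gt0; exact: leq_trans lw.
exfalso; have [vw'|wv'] := lt_total vw.
  have [u [[cu iu] vu uw]] := interior_dense mc prehom ov (conj erefl iv) (conj cw iw) vw'.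
  have ou : ordered (c u) by rewrite cu.
  apply: (@replaceable_between (c v) (i v k) y (i u 0)) xy => //; rewrite ?ci//.
  - by apply: blowup_i => //; apply/nu_gt0.
  - by apply: ilt; rewrite // /lex /= vu.
  - by rewrite yE; apply: ilt; rewrite ?cw// /lex /= uw.
have [u [[cu iu] wu uv]] := interior_dense mc prehom ov (conj cw iw) (conj erefl iv) wv'.
have ou : ordered (c u) by rewrite cu.
apply: (@replaceable_between (c v) y (i v k) (i u 0)) (replaceable_sym Dx Dy xy) => //;
  rewrite ?ci//.
- by apply: blowup_i => //; apply/nu_gt0.
- by rewrite yE; apply: ilt; rewrite ?cw// /lex /= wu.
- by apply: ilt; rewrite // /lex /= uv.
Qed.

Lemma replaceable_next v k : ordered (c v) -> k.+1 < nu v ->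
  replaceable D (i v k) (i v k.+1).
Proof.
move=> ov kv; set x := i v k; set y := i v k.+1.
have xy : lt x y by apply: ilt; rewrite // /lex /= eqxx ltnSn orbT.
have cx : c x = c v by rewrite ci.
have cy : c y = c v by rewrite ci.
apply: (mc_iso mc) => [p [Dp py]|p q [Dp py] [Dq qy] cpq pq].
  by have [->|px] := pselect (p = x); rewrite ?exchL ?exchD ?cx.
have [px|px] := pselect (p = x); have [qx|qx] := pselect (q = x).
- by move: pq; rewrite px qx ltxx.
- rewrite px exchL exchD//; rewrite px in pq cpq.
  have [|//] := lt_total qy => qy'.
  have oq : ordered (c q) by rewrite -cpq cx.
  have [w [l [cw _ qE]]] := Dq oq; have ow : ordered (c w) by rewrite cw.
  have cwv : c w = c v by rewrite cw -cpq.
  have wv : w = v.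
    apply: contrapT => /lt_total[wv|vw].
      by apply: (lt_asym pq); rewrite qE; apply: ilt; rewrite // /lex /= wv.
    by apply: (lt_asym qy'); rewrite qE; apply: ilt; rewrite // /lex /= vw.
  rewrite wv in qE; have [lk|kl] := leqP l k.
    exfalso; move: lk; rewrite leq_eqVlt => /predU1P[lk|lk].
      by apply: qx; rewrite qE lk.
    by apply: (lt_asym pq); rewrite qE; apply: ilt; rewrite // /lex /= eqxx lk orbT.
  exfalso; move: kl; rewrite leq_eqVlt => /predU1P[kl|kl].
    by apply: qy; rewrite qE -kl.
  by apply: (lt_asym qy'); rewrite qE; apply: ilt; rewrite // /lex /= eqxx kl orbT.
- by rewrite qx exchL exchD//; apply: lt_trans xy; rewrite -qx.
- by rewrite !exchD.
Qed.

Lemma component_i v k : ordered (c v) -> k < nu v ->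
  component D (i v k) = i v @` `I_(nu v).
Proof.
move=> ov kv; apply/seteqP; split=> [y yc|_ [l lv <-]] /=.
  apply: (yc (i v @` `I_(nu v))); first by exists k.
  move=> u w [l lv <-] _ Dw uw.
  by have [l' l'v ->] := replaceable_i ov lv Dw uw; exists l'.
move=> C Ck Cclosed.
have step n : n.+1 < nu v -> C (i v n) <-> C (i v n.+1).
  move=> nv; have Dn := blowup_i ov (ltnW nv); have Dn' := blowup_i ov nv.
  have nn := replaceable_next ov nv.
  by split=> Cn; [exact: Cclosed nn|exact: Cclosed (replaceable_sym Dn Dn' nn)].
have C0 n : n < nu v -> C (i v n) <-> C (i v 0).
  elim: n => [//|n IH] nv; rewrite -step// IH//; exact: ltnW.
by apply/(C0 l lv)/(C0 k kv).
Qed.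

Lemma card_component_i v k : ordered (c v) -> k < nu v ->
  component D (i v k) #= `I_(nu v).
Proof.
move=> ov kv; rewrite component_i//; apply: inj_card_eq => k1 k2 _ _ E.
by have [] := i_inj ov erefl E.
Qed.

Lemma component_unordered x : ~ ordered (c x) -> infinite_set [set z | c z = c x] ->
  infinite_set (component D x).
Proof.
move=> nox infx; apply: (sub_infinite_set _ infx) => y /= cy C Cx Cclosed.
have fD z : c z = c x -> D z by move=> cz; rewrite /blowup /= cz.
apply: (Cclosed x y) => //; first exact: fD.
apply: interchangeable_replaceable; apply: contrapT => nxy; apply: nox.
by split=> //; exists x, y.
Qed.

End Blowup.

(** * Counting the siblings *)

Lemma inj_card_le_set (T U : Type) (f : T -> U) (A : set T) (B : set U) :
  {in A &, injective f} -> f @` A `<=` B -> A #<= B.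
Proof. by move=> fI fAB; rewrite -(card_le_eql (inj_card_eq fI)); exact: subset_card_le. Qed.

Section Many.
Context {I : Type} {ar : I -> nat} {R : structure ar}.
Variables (c : R -> nat) (lt : rel R).
Hypothesis mc : multichain c lt.
Hypothesis prehom : prehomogeneous R.
Hypothesis countable_R : countable [set: R].
Variable j : nat.
Hypothesis oj : ordered c j.

(** A sequence of interior points, indexed by pairs (k, l), gets multiplicity
    k + 2 at (k, l) when k is in X, and all other interior points get
    multiplicity 1.  Sizes below 2 carry no information: the shift by 2 avoids
    them. *)
Lemma ex_multiplicity (X : set nat) : exists nu : R -> nat,
  [/\ forall v, (0 < nu v) <-> interior c lt v,
      forall v k, nu v = k.+2 -> X k &
      forall k, X k -> exists2 g : nat -> R, injective g &
        forall l, c (g l) = j /\ nu (g l) = k.+2].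
Proof.
have [h hint hlt] := interior_universal mc prehom oj (countableP _) ltnn ltn_trans.
have hI : injective h.
  move=> m n E; have [mn|nm|//] := ltngtP m n.
    by have := hlt _ _ mn; rewrite E (mc_irr mc).
  by have := hlt _ _ nm; rewrite E (mc_irr mc).
pose code (kl : nat * nat) := h (pickle kl).
have codeI : injective code by move=> p q /hI/(pcan_inj pickleK).
pose size_of v (n : nat) := exists k l, [/\ v = code (k, l), X k & n = k.+2].
pose nu v := if pselect (interior c lt v) then
  (if pselect (exists n, size_of v n) is left e then projT1 (cid e) else 1) else 0.
have nuE k l : X k -> nu (code (k, l)) = k.+2.
  move=> Xk; rewrite /nu; case: (pselect (interior _ _ _)) => /= [_|[]]; last first.
    by have [] := hint (pickle (k, l)).
  case: pselect => [e|[]]; last by exists k.+2, k, l.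
  by case: (cid e) => n sn /=; case: sn => k' [l' [/codeI[-> _] _ ->]].
exists nu; split=> [v|v k|k Xk].
- rewrite /nu; case: (pselect (interior _ _ _)) => [iv|//]; split=> // _.
  by case: pselect => // e; case: (cid e) => n sn /=; case: sn => k [l [_ _ ->]].
- rewrite /nu; case: (pselect (interior _ _ _)) => //= _; case: pselect => // e.
  by case: (cid e) => n sn /=; case: sn => k' [l' [_ Xk' ->]] [<-].
exists (fun l => code (k, l)) => [l l' /codeI[]//|l].
by split; [have [] := hint (pickle (k, l))|exact: nuE].
Qed.

Variables (i : R -> nat -> R) (nu : R -> nat) (X : set nat).
Hypothesis iP : forall v w k l, ordered c (c v) -> c w = c v ->
  [/\ c (i v k) = c v, interior c lt (i v k) &
      lex lt (v, k) (w, l) -> lt (i v k) (i w l)].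
Hypothesis nu_gt0 : forall v, (0 < nu v) <-> interior c lt v.
Hypothesis nu_in : forall v k, nu v = k.+2 -> X k.
Hypothesis nu_many : forall k, X k -> exists2 g : nat -> R, injective g &
  forall l, c (g l) = j /\ nu (g l) = k.+2.

(** Outside the finite label classes a finite component is one of the chains,
    of size nu v. *)
Lemma many_components_blowup k : many_components (blowup c i nu) k.+2 <-> X k.
Proof.
split=> [many|/nu_many[g gI gP]].
  apply: contrapT => nX; apply: many; have [M c_lt] := mc_bounded mc.
  apply: (sub_finite_set _ (finite_fibers c_lt)) => x [Dx cx] /=.
  apply: contrapT => infx; have [ox|nox] := pselect (ordered c (c x)); last first.
    by apply: (@component_unordered _ _ _ c i nu x) => //; apply/finite_setP; exists k.+2.
  have [v [l [cv lv xE]]] := Dx ox; rewrite -cv in ox.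
  apply: nX; apply: (@nu_in v); apply/card_eq_II.
  have := card_component_i mc prehom iP nu_gt0 ox lv.
  by rewrite -xE card_eq_sym => /card_eq_trans; apply.
have gi_inj : injective (fun l => i (g l) 0).
  move=> l l' E; have [cl _] := gP l; have [cl' _] := gP l'.
  have [|//|/gI//] := i_inj mc iP _ _ E; first by rewrite cl.
  by rewrite cl cl'.
have infg : infinite_set [set i (g l) 0 | l in [set: nat]].
  rewrite (eq_finite_set (inj_card_eq (in2W gi_inj))); exact: infinite_nat.
apply: (sub_infinite_set _ infg) => _ [l _ <-]; have [cl nul] := gP l.
have ol : ordered c (c (g l)) by rewrite cl.
split; first by apply: (blowup_i iP) => //; rewrite nul.
by rewrite -nul; apply: (card_component_i mc) => //; rewrite nul.
Qed.

End Many.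

Section Siblings.
Context {I : Type} {ar : I -> nat}.
Implicit Types R S T : structure ar.

Lemma isomorphic_refl R : isomorphic R R.
Proof.
exists id; split; first by exists id.
by move=> i t; rewrite (_ : map_tuple id t = t)//; apply: val_inj; rewrite /= map_id.
Qed.

Lemma isomorphic_sym R S : isomorphic R S -> isomorphic S R.
Proof.
move=> [f [[g fK gK] fR]]; exists g; split; first by exists f.
move=> i t; rewrite fR (_ : map_tuple f _ = t)//.
by apply: val_inj; rewrite /= -map_comp -[RHS]map_id; apply: eq_map.
Qed.

Lemma isomorphic_trans R S T : isomorphic R S -> isomorphic S T -> isomorphic R T.
Proof.
move=> [f [fb fR]] [g [gb gR]]; exists (g \o f); split; first exact: bij_comp.
move=> i t; rewrite fR gR (_ : map_tuple g _ = map_tuple (g \o f) t)//.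
by apply: val_inj; rewrite /= map_comp.
Qed.

Lemma isomorphic_class R S : isomorphic R S -> isomorphic R = isomorphic S.
Proof.
move=> RS; apply/funext => T; apply/propext; split; apply: isomorphic_trans => //.
exact: isomorphic_sym.
Qed.

Definition embedding R S (f : R -> S) : Prop := injective f /\
  forall i (t : (ar i).-tuple R), rel_of R i t <-> rel_of S i (map_tuple f t).

Lemma isomorphism_embedding R S (f : R -> S) : isomorphism f -> embedding f.
Proof. by move=> [fb fR]; split=> //; exact: bij_inj. Qed.

Lemma val_embedding R (A : set R) : embedding (val : restriction A -> R).
Proof. by split=> [|i t]; [exact: val_inj|]. Qed.

Lemma embedding_comp R S T (f : R -> S) (g : S -> T) :
  embedding f -> embedding g -> embedding (g \o f).
Proof.
move=> [fI fR] [gI gR]; split=> [|i t]; first exact: inj_comp.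
rewrite fR gR (_ : map_tuple g _ = map_tuple (g \o f) t)//.
by apply: val_inj; rewrite /= map_comp.
Qed.

Lemma embedding_isomorphic R S (f : R -> S) :
  embedding f -> isomorphic R (restriction (range f)).
Proof.
move=> [fI fR].
have fP x : f x \in range f by apply/mem_set; exists x.
pose h x : restriction (range f) := exist (fun y => y \in range f) (f x) (fP x).
have gP (y : restriction (range f)) : exists x, f x = val y.
  by have /set_mem[x _ <-] := valP y; exists x.
exists h; split=> [|i t]; last first.
  rewrite fR /= (_ : map_tuple val _ = map_tuple f t)//.
  by apply: val_inj; rewrite /= -map_comp.
exists (fun y => projT1 (cid (gP y))) => [x|y].
  by case: cid => z /= /fI.
by case: cid => z /= zy; apply: val_inj.
Qed.

Lemma embeds_embedding R S : embeds R S <-> exists f : R -> S, embedding f.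
Proof.
split=> [[A [f /isomorphism_embedding fe]]|[f fe]].
  by exists (val \o f); apply: embedding_comp fe (val_embedding A).
by exists (range f); exact: embedding_isomorphic.
Qed.

End Siblings.

Section SiblingNumber.
Context {I : Type} {ar : I -> nat} {R : structure ar}.
Hypothesis countable_R : countable [set: R].

Lemma sib_le : sib R #<= [set: set nat].
Proof.
have /countable_injP[code codeI] := countable_R.
apply: (@card_le_trans _ _ _ [set: set R]); last first.
  apply: (@inj_card_le_set _ _ (fun A => code @` A)) => // A B _ _ AB.
  suff sub A' B' : code @` A' = code @` B' -> A' `<=` B'.
    by apply/seteqP; split; exact: sub.
  move=> E x A'x; have : (code @` A') (code x) by exists x.
  by rewrite E => -[y B'y /codeI <-]//; rewrite inE.
apply: card_le_trans (card_image_le (fun A => isomorphic (restriction A)) _).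
apply: subset_card_le => _ [S [[A SA] _] <-]; exists A => //.
by rewrite -(isomorphic_class SA).
Qed.

Lemma sib_single (c : R -> nat) (M : nat) : (forall x, c x < M) ->
  (forall x y, c x = c y -> infinite_set [set z | c z = c x] -> interchangeable x y) ->
  sib R #= `I_1.
Proof.
move=> c_lt c_int; rewrite (_ : sib R = [set (isomorphic R : set _)]) ?card_set1//.
apply/seteqP; split=> [_ [S [[A [a aI]] /embeds_embedding[h he]] <-]|_ ->]; last first.
  have RR : embeds R R.
    have [f fI] := isomorphic_refl R; apply/embeds_embedding; exists f.
    exact: isomorphism_embedding.
  by exists R.
have fe := embedding_comp (embedding_comp he (isomorphism_embedding aI)) (val_embedding A).
set f := val \o _ in fe.
have fR : local_iso setT f by split=> [x y _ _ /fe.1//|i t _]; exact: fe.2.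
have [|g gR gA] := interchangeable_sibling c_lt c_int countable_R (A := A) fR.
  by move=> x; apply/set_mem; apply: (valP (a (h x))).
have /embedding_isomorphic : embedding g.
  by split=> [x y|i t]; [apply: gR.1|apply: gR.2].
rewrite gA => RA; apply/esym/isomorphic_class/(isomorphic_trans RA)/isomorphic_sym.
by exists a.
Qed.

Lemma sib_continuum (c : R -> nat) (lt : rel R) (j : nat) :
  multichain c lt -> prehomogeneous R -> ordered c j -> sib R #= [set: set nat].
Proof.
move=> mc prehom oj; rewrite card_eq_le sib_le /=.
have [i iP] := ex_blowup mc prehom countable_R.
have /choice[nu nuP] := ex_multiplicity mc prehom oj.
pose D X := blowup c i (nu X).
have DP X k : many_components (D X) k.+2 <-> X k.
  by have [n1 n2 n3] := nuP X; exact: (many_components_blowup mc prehom oj iP n1 n2 n3).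
apply: (@inj_card_le_set _ _ (fun X => isomorphic (restriction (D X)))).
  move=> X Y _ _ XY.
  have : isomorphic (restriction (D X)) (restriction (D Y)) by rewrite XY; exact: isomorphic_refl.
  move=> DXY; apply/seteqP; split=> k /DP many; apply/DP.
    by move: DXY => /isomorphic_restrictionP[f fR <-]; exact: many_components_image.
  by move: DXY => /isomorphic_sym/isomorphic_restrictionP[f fR <-]; exact: many_components_image.
move=> _ [X _ <-]; exists (restriction (D X)) => //; split.
  by exists (D X); exact: isomorphic_refl.
have [n1 _ _] := nuP X.
have sq x : squeeze c i x \in D X by apply/mem_set; exact: (squeeze_blowup iP n1).
apply/embeds_embedding.
exists (fun x => exist (fun y => y \in D X) (squeeze c i x) (sq x) : restriction (D X)).
have sqR : local_iso setT (squeeze c i).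
  by apply: (mc_iso mc) => [x _|x y _ _]; [exact: (c_squeeze iP)|exact: (squeeze_lt iP)].
split=> [x y /(congr1 val)/=|k t]; first exact: sqR.1.
rewrite sqR.2//= (_ : map_tuple val _ = map_tuple (squeeze c i) t)//.
by apply: val_inj; rewrite /= -map_comp.
Qed.

End SiblingNumber.

Theorem theorem5p1 (I : Type) (ar : I -> nat) (R : structure ar)
    (countable_R : countable [set: R])
    (prehomogeneous_R : prehomogeneous R)
    (decomposition_R : has_finite_monomorphic_decomposition R) :
  sib R #= `I_1 \/ sib R #= [set: set nat].
Proof.
have [c [lt mc]] := decomposition_multichain countable_R decomposition_R.
have [[j oj]|unordered] := pselect (exists j, ordered c j).
  by right; exact: sib_continuum mc prehomogeneous_R oj.
left; have [M c_lt] := mc_bounded mc; apply: (sib_single countable_R c_lt) => x y cxy infx.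
by apply: contrapT => nxy; apply: unordered; exists (c x); split=> //; exists x, y.
Qed.
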